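(* For every integer $\ell\ge 2$, the rational map $$\rho_\ell:\ \mathbf{G}\big(n-1,H^0(\mathbb{P}^n,\Omega^1_{\mathbb{P}^n}(\ell))\big)\dashrightarrow\mathcal{H}_\ell,\qquad \omega_\zeta=\omega_1\wedge\cdots\wedge\omega_{n-1}\mapsto \mathrm{Sing}(\omega_\zeta),$$ is generically injective.
   Context: We work over $\mathbb{C}$, on the projective space $\mathbb{P}^n$. $\mathbf{G}(n-1,V)$ is the Grassmannian of $(n-1)$-dimensional vector subspaces of $V$. A point of $\mathbf{G}(n-1,H^0(\mathbb{P}^n,\Omega^1_{\mathbb{P}^n}(\ell)))$ with basis $\omega_1,\dots,\omega_{n-1}$ corresponds to a map $\zeta:\mathcal{O}_{\mathbb{P}^n}(-\ell)^{\oplus(n-1)}\to\Omega^1_{\mathbb{P}^n}$ (up to automorphisms of the source), and to the globally decomposable twisted $(n-1)$-form $\omega_\zeta=\omega_1\wedge\cdots\wedge\omega_{n-1}$ (up to nonzero scalar). $\mathrm{Sing}(\omega_\zeta)$ is the zero scheme of $\omega_\zeta$, i.e. the degeneracy scheme of $\zeta$. $\mathcal{H}_\ell$ denotes the union of the components of the Hilbert scheme of $\mathbb{P}^n$ containing the degeneracy locus of a general such map $\zeta$.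
   Formalization: The pair n = 2, ℓ = 3 is excluded, since there the claim fails: the Grassmannian is P^7 while the general zero scheme is 3 points of P^2, a 6-dimensional family, so the map has positive-dimensional fibres; n ≥ 1 is assumed. *)

(* Defs.v *)
From HB Require Import structures.
From mathcomp Require Import all_boot all_order all_algebra.
From mathcomp Require Export complex.
From mathcomp Require Export boolp classical_sets reals.
From mathcomp Require Export mpoly.

Set Implicit Arguments.
Unset Strict Implicit.
Unset Printing Implicit Defensive.

Import GRing.Theory.
Local Open Scope ring_scope.
Local Open Scope classical_set_scope.

Section TwistedForms.
Variables (F : fieldType) (n : nat).

(* (A_0, ..., A_n) stands for the form A_0 dx_0 + ... + A_n dx_n on the affine
   cone, with A_i homogeneous of degree e. *)
Definition cone_form (e : nat) := {ffun 'I_n.+1 -> dhomog n.+1 F e}.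

Section Euler.
Variable e : nat.

Lemma euler_homog (A : cone_form e) :
  \sum_i 'X_i * (A i : {mpoly F[n.+1]}) \is e.+1.-homog.
Proof.
apply: rpred_sum => i _; rewrite -(add1n e); apply: dhomogM.
  by rewrite dhomogX /= mdeg1.
exact: dhomog_is_dhomog.
Qed.

(* Contraction with the radial vector field. *)
Definition euler (A : cone_form e) : dhomog n.+1 F e.+1 :=
  DHomog (euler_homog A).

Lemma euler_linear : linear euler.
Proof.
move=> c A B; apply/val_inj; rewrite /= scaler_sumr -big_split /=.
by apply: eq_bigr => i _; rewrite !ffunE /= mulrDr -scalerAr.
Qed.

HB.instance Definition _ :=
  GRing.isLinear.Build F (cone_form e) (dhomog n.+1 F e.+1) _ euler euler_linear.

End Euler.

(* H^0(P^n, Omega^1(l)) for l >= 1: the Euler sequence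
   0 -> Omega^1(l) -> O(l-1)^(n+1) -> O(l) -> 0 identifies it with the kernel
   of the contraction with the radial vector field. *)
Definition H0Omega1 (l : nat) : {vspace cone_form l.-1} :=
  lker (linfun (@euler l.-1)).

Lemma mem_H0Omega1 l (A : cone_form l.-1) :
  (A \in H0Omega1 l) = (\sum_i 'X_i * (A i : {mpoly F[n.+1]}) == 0).
Proof. by rewrite memv_ker lfunE. Qed.

(* The coefficients of w_1 /\ ... /\ w_k: its value on
   (d/dx_(J 0), ..., d/dx_(J (k-1))).  For increasing J this is the coefficient
   of dx_J; the other J only contribute 0 or a coefficient up to sign. *)
Definition wedge_coef e k (w : k.-tuple (cone_form e))
    (J : {ffun 'I_k -> 'I_n.+1}) : {mpoly F[n.+1]} :=
  \det (\matrix_(i < k, j < k) (tnth w i (J j) : {mpoly F[n.+1]})).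

Definition ideal_gen (T : finType) (g : T -> {mpoly F[n.+1]}) :
    set {mpoly F[n.+1]} :=
  [set f | exists h : T -> {mpoly F[n.+1]}, f = \sum_j h j * g j].

(* Saturation with respect to the irrelevant ideal (x_0, ..., x_n). *)
Definition saturation (I : set {mpoly F[n.+1]}) : set {mpoly F[n.+1]} :=
  [set f | exists N : nat, forall m : 'X_{1..n.+1}, mdeg m = N ->
             I ('X_[m] * f)].

(* A closed subscheme of P^n is encoded by its saturated homogeneous ideal;
   this encoding is bijective. *)
Definition closed_subscheme : set (set {mpoly F[n.+1]}) :=
  [set I | [/\ I 0,
                forall f g, I f -> I g -> I (f + g),
                forall f g, I g -> I (f * g),
                forall f d, I f -> I (pihomog mdeg d f)
              & saturation I `<=` I]].

(* Since Omega^k(kl) is a subbundle of O(k(l-1))^(binomial(n+1,k)), the zero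
   scheme of w_1 /\ ... /\ w_k is cut out by the coefficients above. *)
Definition zero_scheme e k (w : k.-tuple (cone_form e)) :
    set {mpoly F[n.+1]} :=
  saturation (ideal_gen (wedge_coef w)).

(* Another basis of W multiplies the wedge product by a nonzero scalar, so the
   basis chosen is irrelevant. *)
Definition Sing e (W : {vspace cone_form e}) : set {mpoly F[n.+1]} :=
  zero_scheme (vbasis W).

Definition has_hilbert_poly (I : set {mpoly F[n.+1]}) (P : {poly rat}) :=
  exists d0 : nat, forall d : nat, (d0 <= d)%N ->
    exists I_d : {vspace dhomog n.+1 F d},
      (forall f : dhomog n.+1 F d, f \in I_d <-> I (f : {mpoly F[n.+1]})) /\
      P.[d%:R] = (\dim {: dhomog n.+1 F d})%:R - (\dim I_d)%:R.

(* The closed points of the Hilbert scheme of P^n with Hilbert polynomial P.  A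
   family of closed subschemes over a reduced base is flat as soon as its
   members have the same Hilbert polynomial, so an open set of the Grassmannian
   that Sing sends into Hilb P lies in the domain of the rational map W |->
   Sing W to the Hilbert scheme. *)
Definition Hilb (P : {poly rat}) : set (set {mpoly F[n.+1]}) :=
  [set Z | closed_subscheme Z /\ has_hilbert_poly Z P].

End TwistedForms.

Section Grassmannian.
Variables (F : fieldType) (vT : vectType F).

Definition grassmannian (k : nat) (V : {vspace vT}) : set {vspace vT} :=
  [set W | (W <= V)%VS /\ \dim W = k].

(* The coordinates are indexed by all maps 'I_k -> 'I_(\dim V), not only by the
   increasing ones; the redundant ones are 0 or equal up to sign to the usual
   ones. *)
Definition plucker (k : nat) (V : {vspace vT}) (w : k.-tuple vT)
    (a : 'I_#|{ffun 'I_k -> 'I_(\dim V)}|) : F :=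
  \det (\matrix_(i < k, j < k) coord (vbasis V) (enum_val a j) (tnth w i)).

Definition zariski_open (k : nat) (V : {vspace vT}) (U : set {vspace vT}) :=
  U `<=` grassmannian k V /\
  exists Q : set {mpoly F[#|{ffun 'I_k -> 'I_(\dim V)}|]},
    (forall q, Q q -> exists d : nat, q \is d.-homog) /\
    (forall (W : {vspace vT}) (w : k.-tuple vT),
       grassmannian k V W -> basis_of W w ->
       (U W <-> exists2 q, Q q & q.@[@plucker k V w] != 0)).

End Grassmannian.

(* Main.v *)
(* Write n = k + 1 and e = l - 1, and let S = F[x_0, ..., x_n].  The radial vector
   field kills w_1, ..., w_k, so their wedge product is the contraction of a vector
   field X modulo the radial one, and its coefficients are the minors
   p_ij = x_i X_j - x_j X_i.  With M the module of forms killed by the radial field,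
   contraction with X maps M onto the ideal I of these minors.  When the degeneracy
   locus Z has codimension 2 there is an exact sequence
      0 -> S(-l)^k -> M -> I -> 0   (up to a twist of I),
   so I is saturated and its Hilbert function does not depend on the w_r.  If W and
   W' have the same I, the generators x_i dx_j - x_j dx_i of M give p'_ij in I, which
   lift through M -> I to an endomorphism of M: the obstruction lies in
   H^1(T(-l))^k, which vanishes unless (n, l) = (2, 3).  As Omega^1 is simple, this
   endomorphism is a scalar, hence p' is proportional to p and W' = W.
     Every Koszul exactness statement comes from the homotopy given by partial
   derivatives, available in characteristic 0.  Codimension 2 is ensured by the
   stronger open condition that Z misses the line joining the first two coordinate
   points, expressed by a Sylvester determinant in two of the minors. *)
Require Import Defs.
From HB Require Import structures.
From mathcomp Require Import all_boot all_order all_algebra all_fingroup.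
From mathcomp Require Import ring zify.

Set Implicit Arguments.
Unset Strict Implicit.
Unset Printing Implicit Defensive.

Import GRing.Theory Num.Theory.
Local Open Scope ring_scope.

(** * Homogeneous polynomials and Koszul homotopies *)

Section Homogeneous.
Variables (F : fieldType) (n : nat).
Implicit Types (p q : {mpoly F[n]}) (i j : 'I_n).

Lemma mderiv_homog d p i : p \is d.-homog -> p^`M(i) \is d.-1.-homog.
Proof.
move=> /dhomogP hp; apply/dhomogP => m.
rewrite mcoeff_msupp mcoeff_mderiv => nz.
have /hp : (m + U_(i))%MM \in msupp p.
  by rewrite mcoeff_msupp; apply: contraNneq nz => ->; rewrite mul0rn.
by rewrite /= mdegD mdeg1 addn1 => <-.
Qed.

Lemma euler_identity d p : p \is d.-homog ->
  \sum_i 'X_i * p^`M(i) = d%:R *: p.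
Proof.
move=> /dhomogP hp.
have {2}-> := mpolyE p; rewrite scaler_sumr.
under eq_bigr => i _ do rewrite {1}[p]mpolyE raddf_sum mulr_sumr.
rewrite exchange_big /=; apply: eq_big_seq => m /hp /= <-.
rewrite [X in X%:R *: _]mdegE natr_sum scaler_suml; apply: eq_bigr => i _.
rewrite mderivZ mderivX -!scalerAr scalerA mulrC -scalerA.
case: (posnP (m i)) => [->|mi_gt0]; [by rewrite !scale0r | congr (_ *: (_ *: _))].
rewrite -mpolyXD addmC submK //; apply/mnm_lepP => j; rewrite mnm1E.
by case: eqP => // <-.
Qed.

Lemma mderiv_mulX i j q : ('X_j * q)^`M(i) = (i == j)%:R *: q + 'X_j * q^`M(i).
Proof.
rewrite mderivM mderivX mnm1E eq_sym; congr (_ + _).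
case: eqP => [->|_]; last by rewrite !scale0r mul0r.
have -> : (U_(j) - U_(j) = 0)%MM by apply/mnmP => l; rewrite mnmBE mnm0E subnn.
by rewrite !scale1r mpolyX0 mul1r.
Qed.

Lemma sum_mderiv_mulX d q : q \is d.-homog ->
  \sum_i ('X_i * q)^`M(i) = (n + d)%:R *: q.
Proof.
move=> hq; under eq_bigr => i _ do rewrite mderiv_mulX eqxx scale1r.
by rewrite big_split /= (euler_identity hq) sumr_const card_ord -scaler_nat natrD scalerDl.
Qed.

Lemma sum_mderiv_mul1X j (q : 'I_n -> {mpoly F[n]}) :
  \sum_i ('X_j * q i)^`M(i) = q j + 'X_j * \sum_i (q i)^`M(i).
Proof.
under eq_bigr => i _ do rewrite mderiv_mulX.
rewrite big_split /= mulr_sumr (bigD1 j) //= eqxx scale1r big1 ?addr0 //.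
by move=> i /negPf ->; rewrite scale0r.
Qed.

(** Apply the divergence, the sum of all d/dx_i, to the cocycle relation: Euler's identity gives
    [n + d] copies of [u j], and moving x_j across the divergence costs one copy. With two and three
    indices the same computation costs 2 and 3 copies. *)
Lemma koszul_homotopy1 d (u : 'I_n -> {mpoly F[n]}) :
    (forall i, u i \is d.-homog) -> (forall i j, 'X_i * u j = 'X_j * u i) ->
  forall j, (n + d)%:R *: u j = u j + 'X_j * \sum_i (u i)^`M(i).
Proof.
move=> hu xu j; rewrite -sum_mderiv_mul1X -(sum_mderiv_mulX (hu j)).
by apply: eq_bigr => i _; rewrite xu.
Qed.

Lemma koszul_homotopy2 d (t : 'I_n -> 'I_n -> {mpoly F[n]}) :
    (forall i j, t i j \is d.-homog) -> (forall i j, t i j = - t j i) ->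
    (forall i j k, 'X_i * t j k - 'X_j * t i k + 'X_k * t i j = 0) ->
  forall j k, (n + d)%:R *: t j k =
    t j k *+ 2 + ('X_j * \sum_i (t i k)^`M(i) - 'X_k * \sum_i (t i j)^`M(i)).
Proof.
move=> ht ta xt j k.
have: \sum_i ('X_i * t j k - 'X_j * t i k + 'X_k * t i j)^`M(i) = 0.
  by apply: big1 => i _; rewrite xt mderiv0.
under eq_bigr => i _ do rewrite mderivD mderivB.
rewrite big_split sumrB /= (sum_mderiv_mulX (ht j k)) !sum_mderiv_mul1X (ta k j).
by move=> h; apply/eqP; rewrite -subr_eq0 -[X in _ == X]h; apply/eqP; ring.
Qed.

Lemma koszul_homotopy3 d (c : 'I_n -> 'I_n -> 'I_n -> {mpoly F[n]}) :
    (forall i j k, c i j k \is d.-homog) ->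
    (forall i j k, c i j k = - c j i k) -> (forall i j k, c i j k = - c i k j) ->
    (forall i j k l, 'X_i * c j k l - 'X_j * c i k l + 'X_k * c i j l
                     - 'X_l * c i j k = 0) ->
  forall j k l, (n + d)%:R *: c j k l = c j k l *+ 3 +
    ('X_j * \sum_i (c i k l)^`M(i) - 'X_k * \sum_i (c i j l)^`M(i)
     + 'X_l * \sum_i (c i j k)^`M(i)).
Proof.
move=> hc ca cb xc j k l.
have: \sum_i ('X_i * c j k l - 'X_j * c i k l + 'X_k * c i j l
              - 'X_l * c i j k)^`M(i) = 0.
  by apply: big1 => i _; rewrite xc mderiv0.
under eq_bigr => i _ do rewrite mderivB mderivD mderivB.
rewrite sumrB big_split sumrB /= (sum_mderiv_mulX (hc j k l)) !sum_mderiv_mul1X.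
rewrite (ca k j l) (ca l j k) (cb j l k).
by move=> h; apply/eqP; rewrite -subr_eq0 -[X in _ == X]h; apply/eqP; ring.
Qed.

(** Differentiating the relation by x_k expresses [a k] through the x_j times d(a j)/dx_k; Euler's
    identity supplies the other [d] copies of [a k]. *)
Lemma koszul_syzygy d (a : 'I_n -> {mpoly F[n]}) :
    (forall i, a i \is d.-homog) -> \sum_i 'X_i * a i = 0 ->
  forall k, d.+1%:R *: a k = \sum_j 'X_j * ((a k)^`M(j) - (a j)^`M(k)).
Proof.
move=> ha xa k; under eq_bigr => j _ do rewrite mulrBr.
rewrite sumrB (euler_identity (ha k)) -addn1 natrD scalerDl scale1r; congr (_ + _).
have: (\sum_j 'X_j * a j)^`M(k) = 0 by rewrite xa mderiv0.
rewrite raddf_sum /=; under eq_bigr => j _ do rewrite mderiv_mulX.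
rewrite big_split /= (bigD1 k) //= eqxx scale1r big1 ?addr0.
  by move/eqP; rewrite addr_eq0 => /eqP.
by move=> j /negPf; rewrite eq_sym => ->; rewrite scale0r.
Qed.

Lemma dhomog0_const p : p \is 0.-homog -> p = (p@_0%MM)%:MP.
Proof.
move=> hp; apply/mpolyP => m; rewrite mcoeffC eq_sym.
case: eqP => [<-|/eqP nz]; first by rewrite mulr1.
by rewrite mulr0 (dhomog_nemf_coeff hp) //= mdeg_eq0 eq_sym.
Qed.

Lemma mcoeff_filter (P : pred 'X_{1..n}) p m :
  (\sum_(m' <- msupp p | P m') p@_m' *: 'X_[m'])@_m = if P m then p@_m else 0.
Proof.
rewrite raddf_sum /=; have [pm|pm] := boolP (m \in msupp p); last first.
  rewrite big1_seq => [|m' /andP [_ pm']].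
    by move: pm; rewrite -mcoeff_eq0 => /eqP ->; rewrite if_same.
  by rewrite mcoeffZ mcoeffX; case: eqP pm' pm => [->->|]; rewrite ?mulr0.
rewrite big_mkcond (bigD1_seq m) ?msupp_uniq //= big1 ?addr0 => [|m' /negPf ne].
  by case: ifP => // _; rewrite mcoeffZ mcoeffX eqxx mulr1.
by case: ifP => // _; rewrite mcoeffZ mcoeffX ne mulr0.
Qed.

Lemma mpolyX_neq0 m : 'X_[m] != 0 :> {mpoly F[n]}.
Proof.
by apply/eqP => /mpolyP/(_ m)/eqP; rewrite mcoeffX eqxx mcoeff0 oner_eq0.
Qed.

Lemma pihomog_sum_ge k p : (msize p <= k)%N -> p = \sum_(d < k) pihomog mdeg d p.
Proof. exact: pihomog_partitionE. Qed.

Lemma pihomog_mul d e p q : p \is d.-homog ->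
  pihomog mdeg (d + e) (p * q) = p * pihomog mdeg e q.
Proof.
move=> hp; have le_q := leqnn (msize q).
rewrite {1}(pihomog_sum_ge (leq_addr e.+1 (msize q))) mulr_sumr raddf_sum /=.
have lt_e : (e < msize q + e.+1)%N by rewrite addnS ltnS leq_addl.
rewrite (bigD1 (Ordinal lt_e)) //= big1 ?addr0 => [|i ne_i].
  by rewrite pihomog_dE // dhomogM // pihomogP.
rewrite (@pihomog_ne0 _ _ _ (d + i)) ?dhomogM ?pihomogP //.
by rewrite eqn_add2l; apply: contraNneq ne_i => /= ie; apply/eqP/val_inj.
Qed.

Lemma pihomog_mul_lt d e p q : p \is d.-homog -> (e < d)%N ->
  pihomog mdeg e (p * q) = 0.
Proof.
move=> hp ed; rewrite (pihomog_sum_ge (leqnn (msize q))) mulr_sumr raddf_sum /=.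
apply: big1 => i _; rewrite (@pihomog_ne0 _ _ _ (d + i)) ?dhomogM ?pihomogP //.
by rewrite neq_ltn (leq_trans ed (leq_addr _ _)) orbT.
Qed.

Lemma dhomog_mulI d e p q : p != 0 -> p \is d.-homog -> p * q \is (d + e).-homog ->
  q \is e.-homog.
Proof.
move=> p0 hp hpq; rewrite homog_piE; apply/eqP/(mulfI p0).
by rewrite -(pihomog_mul e q hp) pihomog_dE.
Qed.

End Homogeneous.

Section Syzygies.
Variables (F : fieldType) (n : nat).
Hypothesis F0 : [pchar F] =i pred0.

(** [koszul_syzygy] solves each homogeneous component, characteristic 0 allowing the division by the
    degree plus one; [K] bounds the degrees that occur. *)
Lemma koszul_exact (a : 'I_n -> {mpoly F[n]}) : \sum_i 'X_i * a i = 0 ->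
  exists b : 'I_n -> 'I_n -> {mpoly F[n]},
    (forall i j, b i j = - b j i) /\ (forall k, a k = \sum_j 'X_j * b j k).
Proof.
move=> xa; pose K := (\max_i msize (a i))%N.
pose ad d i := pihomog mdeg d (a i).
have xad d : \sum_i 'X_i * ad d i = 0.
  have := congr1 (pihomog mdeg d.+1) xa.
  rewrite raddf0 raddf_sum /= => xad; rewrite -[RHS]xad.
  apply: eq_bigr => i _.
  by rewrite -(add1n d) pihomog_mul // dhomogX /= mdeg1.
pose b i j := \sum_(d < K) d.+1%:R^-1 *: ((ad d j)^`M(i) - (ad d i)^`M(j)).
exists b; split=> [i j|k].
  rewrite /b -sumrN; apply: eq_bigr => d _; rewrite -scalerN opprB //.
have /pihomog_sum_ge -> : (msize (a k) <= K)%N by apply: leq_bigmax.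
under [RHS]eq_bigr => j _ do rewrite /b mulr_sumr.
rewrite [RHS]exchange_big /=; apply: eq_bigr => d _.
rewrite -/(ad d k); under [RHS]eq_bigr => j _ do rewrite -scalerAr.
rewrite -scaler_sumr -(@koszul_syzygy _ _ d _ _ (xad d)) => [|i]; last exact: pihomogP.
by rewrite scalerA mulVf ?scale1r // ((pcharf0P F).1 F0).
Qed.

End Syzygies.

(** * Pairs of forms without common zero on a line *)

Section MonomialDivision.
Variables (F : fieldType) (n : nat).
Implicit Types (a b c q : {mpoly F[n]}) (m : 'X_{1..n}).

Lemma mcoeff_mulX m0 q m :
  ('X_[m0] * q)@_m = if (m0 <= m)%MM then q@_(m - m0) else 0.
Proof.
rewrite mulrC; case: ifP => [le_m|nle_m].
  by rewrite -{1}(submK le_m) addmC mcoeffMX.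
apply/eqP; rewrite mcoeff_eq0 (perm_mem (msuppMX _ _)).
apply/mapP => -[m' _ m_eq]; move: nle_m; rewrite m_eq lem_addr //.
Qed.

Lemma mem_monomial_ideal2 m1 m2 q :
    {in msupp q, forall m, (m1 <= m)%MM || (m2 <= m)%MM} ->
  exists c c', q = 'X_[m1] * c + 'X_[m2] * c'.
Proof.
move=> hq; rewrite [q]mpolyE big_seq.
apply: (big_ind (fun p => exists c c', p = 'X_[m1] * c + 'X_[m2] * c')).
- by exists 0, 0; rewrite !mulr0 addr0.
- move=> _ _ [c [c' ->]] [d [d' ->]]; exists (c + d), (c' + d').
  by rewrite !mulrDr addrACA.
move=> m /hq /orP [] le_m; rewrite -(submK le_m) mpolyXD.
  by exists (q@_(m - m1 + m1) *: 'X_[m - m1]), 0; rewrite mulr0 addr0 -scalerAr [in RHS]mulrC.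
by exists 0, (q@_(m - m2 + m2) *: 'X_[m - m2]); rewrite mulr0 add0r -scalerAr [in RHS]mulrC.
Qed.

Lemma lem_mulm1 i N m : (U_(i) *+ N <= m)%MM = (N <= m i)%N.
Proof.
apply/mnm_lepP/idP => [/(_ i)|le_N j]; rewrite mulmnE mnm1E ?eqxx ?mul1n //.
by case: eqP => [<-|]; rewrite ?mul1n ?mul0n.
Qed.

(** A monomial divisible by neither x_i^N nor x_j^N stays so after multiplication by x_l^N, so its
    coefficient in [b] vanishes. The case [i = j] is allowed and gives the statement for a single
    power. *)
Lemma monomial_colon (i j l : 'I_n) N b c c' : l != i -> l != j ->
    'X_[U_(l) *+ N] * b = 'X_[U_(i) *+ N] * c + 'X_[U_(j) *+ N] * c' ->
  exists d d', b = 'X_[U_(i) *+ N] * d + 'X_[U_(j) *+ N] * d'.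
Proof.
move=> li lj eq_b; apply: mem_monomial_ideal2 => m; apply: contraTT.
rewrite !lem_mulm1 negb_or -mcoeff_eq0 => /andP [/negPf Ni /negPf Nj].
have := congr1 (mcoeff (m + U_(l) *+ N)) eq_b.
rewrite mcoeffD !mcoeff_mulX !lem_mulm1 !mnmDE !mulmnE !mnm1E eqxx mul1n leq_addl.
by rewrite addmK (negPf li) (negPf lj) !mul0n !addn0 Ni Nj addr0 => ->.
Qed.

Lemma monomial_regular (i l : 'I_n) N b c : l != i ->
  'X_[U_(l) *+ N] * b = 'X_[U_(i) *+ N] * c -> exists d, b = 'X_[U_(i) *+ N] * d.
Proof.
move=> li eq_b; have [|d [d' ->]] := @monomial_colon i i l N b c 0 li li.
  by rewrite eq_b mulr0 addr0.
by exists (d + d'); rewrite mulrDr.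
Qed.

End MonomialDivision.

Section RegularPair.
Variables (F : fieldType) (n : nat) (i0 i1 : 'I_n) (N : nat).
Hypothesis i01 : i0 != i1.
Implicit Types (a b c q : {mpoly F[n]}) (m : 'X_{1..n}).

(* The order of vanishing of a monomial along the line spanned by the coordinate
   points i0 and i1. *)
Definition off_line m : nat := \sum_(i | (i != i0) && (i != i1)) m i.

(** Membership in the [r]-th power of the ideal of the line, which is generated by the other
    variables. *)
Definition vanishes_to r a := forall m, (off_line m < r)%N -> a@_m = 0.

(** Two such [G], one for [i0] and one for [i1], have no common zero on the line. *)
Definition restricts_to_power (j : 'I_n) (G : {mpoly F[n]}) :=
  G \is N.-homog /\ forall m, off_line m = 0%N -> G@_m = (m == U_(j) *+ N)%MM%:R.

Lemma off_lineD m m' : off_line (m + m')%MM = (off_line m + off_line m')%N.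
Proof. by rewrite -big_split; apply: eq_bigr => i _; rewrite mnmDE. Qed.

Lemma off_line_le m : (off_line m <= mdeg m)%N.
Proof. by rewrite mdegE [leqRHS](bigID (fun i => (i != i0) && (i != i1))) leq_addr. Qed.

Lemma off_line_pow j : (j == i0) || (j == i1) -> off_line (U_(j) *+ N)%MM = 0%N.
Proof.
move=> hj; rewrite /off_line big1 // => i /andP [ne0 ne1]; rewrite mulmnE mnm1E.
by move: hj; have [->|_ _] := eqVneq j i; rewrite ?mul0n // (negPf ne0) (negPf ne1).
Qed.

Lemma vanishes_toM r s a b :
  vanishes_to r a -> vanishes_to s b -> vanishes_to (r + s) (a * b).
Proof.
move=> ha hb m lt_m; apply/eqP; rewrite mcoeff_eq0; apply/negP.
move=> /msuppM_le /allpairsP [[m1 m2] /= [ha1 hb2 m_eq]].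
move: ha1 hb2 lt_m; rewrite !mcoeff_msupp m_eq off_lineD => ha1 hb2.
rewrite ltnNge leq_add // leqNgt.
  by apply: contra ha1 => /ha ->.
by apply: contra hb2 => /hb ->.
Qed.

(** [G] differs from x_j^N by an element of the ideal of the line, so up to order [r] only the
    product with x_j^N is seen. *)
Lemma mcoeff_mul_restricts r j G a m : restricts_to_power j G ->
    (j == i0) || (j == i1) -> vanishes_to r a -> (off_line m <= r)%N ->
  (a * G)@_m = ('X_[U_(j) *+ N] * a)@_m.
Proof.
move=> [_ hG] hj ha le_m.
have hG' : vanishes_to 1 (G - 'X_[U_(j) *+ N]).
  move=> m'; rewrite ltnS leqn0 => /eqP wm'.
  by rewrite mcoeffB hG // mcoeffX eq_sym subrr.
rewrite -[G](subrK 'X_[U_(j) *+ N]) mulrDr mcoeffD (vanishes_toM ha hG').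
  by rewrite add0r mulrC.
by rewrite addn1 ltnS.
Qed.

Lemma vanishes_to_mul_cancel r j G a : restricts_to_power j G ->
    (j == i0) || (j == i1) -> vanishes_to r a -> vanishes_to r.+1 (a * G) ->
  vanishes_to r.+1 a.
Proof.
move=> hG hj ha haG m; rewrite ltnS => le_m.
have wm : off_line (m + U_(j) *+ N)%MM = off_line m.
  by rewrite off_lineD off_line_pow // addn0.
have := haG (m + U_(j) *+ N)%MM; rewrite wm ltnS => /(_ le_m).
rewrite (mcoeff_mul_restricts hG hj ha) ?wm //.
by rewrite mcoeff_mulX lem_addl addmK.
Qed.

(** Induction on [t], which bounds how far the order [r] is from exceeding the degree [e]. In lowest
    order the equation reads a x_i1^N = b x_i0^N, so x_i0^N divides the leading part of [a];
    subtracting the quotient times [G0] from [a] and times [G1] from [b] raises both orders. *)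
Lemma regular_pair_homog e r t (G0 G1 a b : {mpoly F[n]}) :
    restricts_to_power i0 G0 -> restricts_to_power i1 G1 ->
    a \is e.-homog -> (e < r + t)%N -> vanishes_to r a -> vanishes_to r b ->
  a * G1 = b * G0 -> exists c, a = c * G0.
Proof.
move=> hG0 hG1; have h0 : (i0 == i0) || (i0 == i1) by rewrite eqxx.
have h1 : (i1 == i0) || (i1 == i1) by rewrite eqxx orbT.
elim: t r a b => [|t IH] r a b ha er va vb eq_ab.
  exists 0; rewrite mul0r; apply/mpolyP => m; rewrite mcoeff0.
  have [me|/(dhomog_nemf_coeff ha) //] := eqVneq (mdeg m) e.
  by apply: va; rewrite (leq_ltn_trans (off_line_le m)) // me -(addn0 r).
have le_N0 m : a@_m != 0 -> off_line m = r -> (U_(i0) *+ N <= m)%MM.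
  move=> nz wm; have wm1 : (off_line (m + U_(i1) *+ N)%MM <= r)%N.
    by rewrite off_lineD off_line_pow // addn0 wm.
  have := congr1 (mcoeff (m + U_(i1) *+ N)%MM) eq_ab.
  rewrite (mcoeff_mul_restricts hG1 h1 va wm1) (mcoeff_mul_restricts hG0 h0 vb wm1).
  rewrite !mcoeff_mulX lem_addl addmK !lem_mulm1 mnmDE mulmnE mnm1E eq_sym (negPf i01).
  by rewrite mul0n addn0; case: ifP => // _ a0; rewrite a0 eqxx in nz.
(* The part of [a] of exact order [r], divided by x_i0^N. *)
pose c := \sum_(m <- msupp a | off_line m == r) a@_m *: 'X_[m - U_(i0) *+ N].
have cX : 'X_[U_(i0) *+ N] * c = \sum_(m <- msupp a | off_line m == r) a@_m *: 'X_[m].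
  rewrite mulr_sumr big_seq_cond [RHS]big_seq_cond.
  apply: eq_bigr => m /andP [am /eqP wm].
  rewrite -scalerAr -mpolyXD addmC submK // le_N0 //.
  by rewrite -mcoeff_msupp.
have cXm m : ('X_[U_(i0) *+ N] * c)@_m = if off_line m == r then a@_m else 0.
  by rewrite cX mcoeff_filter.
have vc : vanishes_to r c.
  move=> m lt_m; have := cXm (m + U_(i0) *+ N)%MM.
  rewrite mcoeff_mulX lem_addl addmK off_lineD off_line_pow // addn0 => ->.
  by rewrite ltn_eqF.
have cG : c * G0 \is e.-homog.
  have [c0|c_nz] := eqVneq c 0; first by rewrite c0 mul0r dhomog0.
  have cXe : 'X_[U_(i0) *+ N] * c \is e.-homog.
    rewrite cX big_seq_cond rpred_sum // => m /andP [am _]; rewrite rpredZ // dhomogX.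
    by apply/eqP; move/dhomogP: ha => /(_ _ am).
  have X0 := mpolyX_neq0 F (U_(i0) *+ N)%MM.
  have XN : ('X_[U_(i0) *+ N] : {mpoly F[n]}) \is N.-homog.
    by rewrite dhomogX /= mdegMn mdeg1 mul1n.
  have [le_e|lt_e] := leqP N e.
    rewrite -(subnKC le_e) mulrC dhomogM ?(proj1 hG0) //.
    by apply: dhomog_mulI X0 XN _; rewrite subnKC.
  have := pihomog_mul_lt c XN lt_e; rewrite pihomog_dE // => /eqP.
  by rewrite mulf_eq0 (negPf X0) (negPf c_nz).
have va' : vanishes_to r.+1 (a - c * G0).
  move=> m; rewrite ltnS => le_m.
  rewrite mcoeffB (mcoeff_mul_restricts hG0 h0 vc le_m) cXm.
  case: eqP => [_|/eqP ne]; first by rewrite subrr.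
  by rewrite va ?subr0 // ltn_neqAle ne.
(* Only [a] was arranged to gain an order; [b] inherits it through the equation, since [G0] can be
   cancelled. *)
have vb' : vanishes_to r.+1 (b - c * G1).
  have eq_ab' : (b - c * G1) * G0 = (a - c * G0) * G1.
    by rewrite !mulrBl eq_ab mulrAC.
  apply: vanishes_to_mul_cancel hG0 h0 _ _; last first.
    rewrite eq_ab' -[r.+1]addn0; apply: vanishes_toM => // m; by rewrite ltn0.
  move=> m lt_m; rewrite mcoeffB vb // (mcoeff_mul_restricts hG1 h1 vc (ltnW lt_m)).
  rewrite mcoeff_mulX; case: ifP => [le_m|]; rewrite ?subr0 // vc ?subr0 //.
  by move: lt_m; rewrite -{1}(submK le_m) off_lineD off_line_pow // addn0.
have [|||c' eq_c'] := IH r.+1 (a - c * G0) (b - c * G1) _ _ va' vb' _.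
- by rewrite rpredB.
- by rewrite addSnnS.
- by rewrite !mulrBl eq_ab mulrAC.
by exists (c' + c); rewrite mulrDl -eq_c' subrK.
Qed.

Lemma regular_pair (G0 G1 a b : {mpoly F[n]}) :
    restricts_to_power i0 G0 -> restricts_to_power i1 G1 ->
  a * G1 = b * G0 -> exists c, a = c * G0.
Proof.
move=> hG0 hG1 eq_ab; rewrite (pihomog_sum_ge (leqnn (msize a))).
apply: (big_ind (fun p => exists c, p = c * G0)).
- by exists 0; rewrite mul0r.
- by move=> _ _ [c ->] [d ->]; exists (c + d); rewrite mulrDl.
move=> e _; apply: (@regular_pair_homog e 0 e.+1 _ G1 _ (pihomog mdeg e b)) => //.
- exact: pihomogP.
- rewrite mulrC -(pihomog_mul e a (proj1 hG1)) [RHS]mulrC -(pihomog_mul e b (proj1 hG0)).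
  by rewrite [G1 * a]mulrC [G0 * b]mulrC eq_ab.
Qed.

End RegularPair.

(** * Determinants bordered by two rows *)

Section BorderedMinors.
Variables (S : comNzRingType) (k : nat).
Implicit Types (W : 'M[S]_(k, k.+2)) (y z v : 'rV[S]_k.+2).

(** The cofactors along row [r] ignore that row, so the entry is the Laplace expansion of [A] with
    row [r] replaced by [v]. *)
Lemma mul_adj_row n (v : 'rV[S]_n) (A B : 'M[S]_n) r :
    (forall j, B r j = v 0 j) -> (forall i j, i != r -> B i j = A i j) ->
  (v *m \adj A) 0 r = \det B.
Proof.
move=> rB r'B; rewrite mxE (expand_det_row B r); apply: eq_bigr => j _.
rewrite rB !mxE; congr (_ * (_ * \det _)).
by apply/matrixP => i l; rewrite !mxE r'B // eq_sym neq_lift.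
Qed.

Definition border y z W : 'M[S]_k.+2 := col_mx y (col_mx z W).

Definition top0 : 'I_k.+2 := lshift (1 + k) (0 : 'I_1).
Definition top1 : 'I_k.+2 := rshift 1 (lshift k (0 : 'I_1)).
Definition below (r : 'I_k) : 'I_k.+2 := rshift 1 (rshift 1 r).

Variant row_spec : 'I_k.+2 -> Type :=
| RowSpec0 : row_spec top0
| RowSpec1 : row_spec top1
| RowSpec2 r : row_spec (below r).

Lemma row_specP i : row_spec i.
Proof.
rewrite -(@splitK 1 (1 + k) i); case: split => [j|j]; first by rewrite ord1; constructor.
rewrite -(@splitK 1 k j); case: split => [l|l]; first by rewrite ord1; constructor.
exact: RowSpec2.
Qed.

Lemma borderE0 y z W j : border y z W top0 j = y 0 j.
Proof. exact: col_mxEu. Qed.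

Lemma borderE1 y z W j : border y z W top1 j = z 0 j.
Proof. exact: etrans (@col_mxEd _ 1 (1 + k) _ _ _ _ _) (col_mxEu _ _ _ _). Qed.

Lemma borderE2 y z W r j : border y z W (below r) j = W r j.
Proof. exact: etrans (@col_mxEd _ 1 (1 + k) _ _ _ _ _) (col_mxEd _ _ _ _). Qed.

Definition borderE := (borderE0, borderE1, borderE2).

Lemma sum_row (V : nmodType) (f : 'I_k.+2 -> V) :
  \sum_i f i = f top0 + (f top1 + \sum_r f (below r)).
Proof.
rewrite (@big_split_ord _ _ _ 1 (1 + k)) big_ord1; congr (_ + _).
by rewrite (@big_split_ord _ _ _ 1 k) big_ord1.
Qed.

Lemma mul_adj_border0 y z W v :
  (v *m \adj (border y z W)) 0 top0 = \det (border v z W).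
Proof.
apply: mul_adj_row => [j|i j]; first by rewrite borderE.
by case: (row_specP i) => [||r]; rewrite ?eqxx // !borderE.
Qed.

Lemma mul_adj_border1 y z W v :
  (v *m \adj (border y z W)) 0 top1 = \det (border y v W).
Proof.
apply: mul_adj_row => [j|i j]; first by rewrite borderE.
by case: (row_specP i) => [||r]; rewrite ?eqxx // !borderE.
Qed.

Lemma det_border_sym y z W : \det (border y z W) = - \det (border z y W).
Proof.
have -> : border y z W = xrow top0 top1 (border z y W).
  apply/matrixP => i j; rewrite [RHS]mxE; case: (row_specP i) => [||r].
  - by rewrite tpermL !borderE.
  - by rewrite tpermR !borderE.
  by rewrite tpermD ?borderE // -val_eqE.
by rewrite xrowE det_mulmx det_perm odd_tperm mulN1r.
Qed.

Lemma det_border_row y W r : \det (border y (row r W) W) = 0.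
Proof.
apply: (@determinant_alternate _ _ _ top1 (below r)) => [|j].
  by rewrite -val_eqE.
by rewrite !borderE mxE.
Qed.

Lemma det_border_expand y z W :
  \det (border y z W) = \sum_k z 0 k * \det (border y (delta_mx 0 k) W).
Proof.
rewrite -(mul_adj_border1 y z) mxE; apply: eq_bigr => j _; congr (_ * _).
by rewrite -(mul_adj_border1 y z) -rowE [RHS]mxE.
Qed.

(** Apply adj(B) B = det(B) to [x]: the rows of [W] kill [x], so only the terms of the two border
    rows remain. *)
Lemma det_border_koszul W (x : 'cV[S]_k.+2) y z i : W *m x = 0 ->
  \det (border y z W) * x i 0 =
    (y *m x) 0 0 * \det (border (delta_mx 0 i) z W)
    - (z *m x) 0 0 * \det (border (delta_mx 0 i) y W).
Proof.
move=> Wx0.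
have := congr1 (fun B => (delta_mx (0 : 'I_1) i *m B *m x) 0 0) (mul_adj_mx (border y z W)).
rewrite /= mul_mx_scalar -scalemxAl => eq_x.
have <- : (\det (border y z W) *: (delta_mx (0 : 'I_1) i *m x)) 0 0 =
    \det (border y z W) * x i 0 by rewrite -rowE !mxE.
rewrite -{}eq_x.
have Bx r : (border y z W *m x) r 0 = \sum_j border y z W r j * x j 0 by rewrite mxE.
have B0 : (border y z W *m x) top0 0 = (y *m x) 0 0.
  by rewrite Bx mxE; apply: eq_bigr => j _; rewrite borderE.
have B1 : (border y z W *m x) top1 0 = (z *m x) 0 0.
  by rewrite Bx mxE; apply: eq_bigr => j _; rewrite borderE.
have B2 r : (border y z W *m x) (below r) 0 = 0.
  have /matrixP/(_ r 0) := Wx0; rewrite [RHS]mxE => <-.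
  by rewrite Bx mxE; apply: eq_bigr => j _; rewrite borderE.
rewrite mulmxA -mulmxA mxE sum_row mul_adj_border0 mul_adj_border1 B0 B1.
rewrite [\det (border y _ W)]det_border_sym big1 ?addr0 => [|r _].
  by rewrite mulrC mulNr [X in _ - X]mulrC.
by rewrite B2 mulr0.
Qed.

(** By Cramer's rule the coordinates of [a] along [y] and [z] are the two determinants assumed to
    vanish; those along [W] remain. *)
Lemma det_border_cramer W y z (a : 'rV[S]_k.+2) :
    \det (border y a W) = 0 -> \det (border z a W) = 0 ->
  exists c : 'rV[S]_k, \det (border y z W) *: a = c *m W.
Proof.
move=> ya za; exists (\row_r (a *m \adj (border y z W)) 0 (below r)).
have := congr1 (mulmx a) (mul_adj_mx (border y z W)).
rewrite mulmxA mul_mx_scalar => <-; apply/rowP => j.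
rewrite mxE sum_row mul_adj_border0 mul_adj_border1 det_border_sym za ya.
rewrite oppr0 !mul0r !add0r mxE; apply: eq_bigr => r _.
by rewrite borderE !mxE.
Qed.

(** Padding [c] with two zeros gives a row killed by the bordered matrix, hence by its
    determinant. *)
Lemma det_border_free W y z (c : 'rV[S]_k) : c *m W = 0 ->
  \det (border y z W) *: c = 0.
Proof.
move=> cW; pose v : 'rV_k.+2 := row_mx (0 : 'rV_1) (row_mx (0 : 'rV_1) c).
have v0 : v 0 top0 = 0 by apply: etrans (row_mxEl _ _ _ _) _; rewrite mxE.
have v1 : v 0 top1 = 0.
  by apply: etrans (@row_mxEr _ _ 1 (1 + k) _ _ _ _) _; rewrite row_mxEl mxE.
have v2 r : v 0 (below r) = c 0 r.
  by apply: etrans (@row_mxEr _ _ 1 (1 + k) _ _ _ _) _; rewrite row_mxEr.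
have vB : v *m border y z W = 0.
  rewrite -cW; apply/rowP => j; rewrite [LHS]mxE sum_row v0 v1 !mul0r !add0r [RHS]mxE.
  by apply: eq_bigr => r _; rewrite v2 borderE.
have := congr1 (mulmx v) (mul_mx_adj (border y z W)).
rewrite mulmxA vB mul0mx mul_mx_scalar => /esym /rowP dv.
by apply/rowP => r; have := dv (below r); rewrite mxE v2 [RHS]mxE => dvr; rewrite mxE dvr mxE.
Qed.

Lemma det_row_delta n (A : 'M[S]_n.+1) : (forall j, A ord0 j = (j == ord0)%:R) ->
  \det A = \det (\matrix_(i, j) A (lift ord0 i) (lift ord0 j)).
Proof.
move=> A0; rewrite (expand_det_row A ord0) (bigD1 ord0) //= big1 => [|j /negPf j0].
  rewrite addr0 A0 eqxx mul1r /cofactor expr0 mul1r; congr (\det _).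
  by apply/matrixP => i j; rewrite !mxE.
by rewrite A0 j0 mul0r.
Qed.

(** Permuting the columns by [s] turns the border rows into the first two unit rows, and two Laplace
    expansions leave the minor on the other columns. *)
Lemma det_border_perm W (s : 'S_k.+2) :
  \det (border (delta_mx 0 (s top0)) (delta_mx 0 (s top1)) W) =
    (-1) ^+ s * \det (\matrix_(i, j) W i (s (below j))).
Proof.
set B := border _ _ _; have -> : \det B = (-1) ^+ s * \det (col_perm s B).
  by rewrite col_permE det_mulmx det_perm odd_permV mulrC -mulrA -signr_addb addbb mulr1.
have top0E : top0 = ord0 by apply: val_inj.
have top1E : top1 = lift ord0 ord0 by apply: val_inj.
have belowE r : below r = lift ord0 (lift ord0 r) by apply: val_inj.
congr (_ * _); rewrite !det_row_delta => [|j|j].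
- by congr (\det _); apply/matrixP => i j; rewrite 3![LHS]mxE [RHS]mxE -!belowE borderE.
- rewrite mxE [LHS]mxE -top1E borderE mxE eqxx (inj_eq perm_inj) top1E.
  by rewrite (inj_eq lift_inj).
- by rewrite mxE -top0E borderE mxE eqxx (inj_eq perm_inj).
Qed.

End BorderedMinors.

(** * The ideal of maximal minors *)

Section IdealGen.
Variables (F : fieldType) (n : nat).

Lemma ideal_genMn (T : finType) (g : T -> {mpoly F[n.+1]}) :
  [/\ ideal_gen g 0,
      forall p q, ideal_gen g p -> ideal_gen g q -> ideal_gen g (p + q),
      forall p q, ideal_gen g q -> ideal_gen g (p * q)
    & forall t, ideal_gen g (g t)].
Proof.
split=> [|_ _ [h ->] [h' ->]|p _ [h ->]|t].
- by exists (fun=> 0); rewrite big1 // => t _; rewrite mul0r.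
- by exists (fun t => h t + h' t); rewrite -big_split; apply: eq_bigr => t _; rewrite mulrDl.
- by exists (fun t => p * h t); rewrite mulr_sumr; apply: eq_bigr => t _; rewrite mulrA.
exists (fun t' => (t' == t)%:R); rewrite (bigD1 t) //= eqxx mul1r big1 ?addr0 //.
by move=> t' /negPf ->; rewrite mul0r.
Qed.

Lemma ideal_gen_sub (T T' : finType) (g : T -> {mpoly F[n.+1]}) (g' : T' -> {mpoly F[n.+1]}) :
  (forall t, ideal_gen g' (g t)) -> forall p, ideal_gen g p -> ideal_gen g' p.
Proof.
move=> gg' _ [h ->]; have [g0 gD gM _] := ideal_genMn g'.
by apply: (big_ind (ideal_gen g')) => // t _; apply: gM.
Qed.

Lemma ideal_gen_pihomog (T : finType) (g : T -> {mpoly F[n.+1]}) e d p :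
    (forall t, g t \is e.-homog) -> ideal_gen g p ->
  ideal_gen g (pihomog mdeg d p).
Proof.
move=> hg [h ->]; have [g0 gD gM gg] := ideal_genMn g; rewrite raddf_sum /=.
apply: (big_ind (ideal_gen g)) => // t _; rewrite mulrC.
have [le_e|lt_d] := leqP e d; last by rewrite (pihomog_mul_lt _ (hg t)).
by rewrite -(subnKC le_e) (pihomog_mul _ _ (hg t)) mulrC; apply: gM.
Qed.

Lemma prod_homog e (I : Type) (r : seq I) (f : I -> {mpoly F[n]}) :
  (forall i, f i \is e.-homog) -> \prod_(i <- r) f i \is (size r * e).-homog.
Proof.
move=> hf; elim: r => [|i r IH]; first by rewrite big_nil dhomog1.
by rewrite big_cons mulSn dhomogM.
Qed.

Lemma det_homog m e (A : 'M[{mpoly F[n]}]_m) :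
  (forall i j, A i j \is e.-homog) -> \det A \is (m * e).-homog.
Proof.
move=> hA; rewrite rpred_sum // => s _.
have hprod : \prod_(i < m) A i (s i) \is (m * e).-homog.
  rewrite -big_enum /=; have := @prod_homog e _ (enum 'I_m) (fun i => A i (s i)).
  by rewrite size_enum_ord; apply.
by rewrite -signr_odd mulr_sign; case: ifP; rewrite ?dhomogN.
Qed.

End IdealGen.

(** * The minors as a bivector divisible by the radial field *)

Section DegeneracyIdeal.
Variables (F : fieldType) (k e : nat).
Local Notation S := {mpoly F[k.+2]}.

Definition var_col : 'cV[S]_k.+2 := \col_i 'X_i.

(** Up to sign the maximal minor omitting the columns [ij.1] and [ij.2]; the sign makes it a
    coefficient of the bivector dual to w_1 /\ ... /\ w_k. *)
Definition bminor (W : 'M[S]_(k, k.+2)) (ij : 'I_k.+2 * 'I_k.+2) : S :=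
  \det (border (delta_mx 0 ij.1) (delta_mx 0 ij.2) W).

Lemma mul_var_col (a : 'rV[S]_k.+2) :
  (a *m var_col == 0) = (\sum_i 'X_i * a 0 i == 0).
Proof.
apply/eqP/eqP => [/rowP/(_ 0)|xa]; last (apply/rowP => j; rewrite ord1).
  rewrite !mxE => xa; rewrite -[RHS]xa; apply: eq_bigr => i _; rewrite mxE mulrC //.
rewrite !mxE -[RHS]xa; apply: eq_bigr => i _; rewrite mxE mulrC //.
Qed.

Lemma mul_delta_var_col (i : 'I_k.+2) : (delta_mx 0 i *m var_col) = ('X_i : S)%:M.
Proof. by rewrite -rowE; apply/rowP => j; rewrite ord1 !mxE eqxx. Qed.

Section Fixed.
Variable W : 'M[S]_(k, k.+2).
Hypothesis hW : forall i j, W i j \is e.-homog.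
Hypothesis Wx : W *m var_col = 0.
Let p i j := bminor W (i, j).

Lemma exists_perm2 (i j : 'I_k.+2) : i != j ->
  exists s : 'S_k.+2, s (top0 k) = i /\ s (top1 k) = j.
Proof.
move=> ij; pose s1 := tperm (top0 k) i; pose s := (s1 * tperm (s1 (top1 k)) j)%g.
exists s; rewrite !permM tpermL; split; last by rewrite tpermL.
rewrite tpermD // 1?eq_sym //.
by rewrite -(tpermL (top0 k) i) (inj_eq perm_inj).
Qed.

Lemma bminor_antisym i j : p i j = - p j i.
Proof. exact: det_border_sym. Qed.

Lemma bminor_diag i : p i i = 0.
Proof.
apply: (@determinant_alternate _ _ _ (top0 k) (top1 k)) => [|j]; first by rewrite -val_eqE.
by rewrite !borderE.
Qed.

Lemma bminor_homog i j : p i j \is (k * e).-homog.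
Proof.
have [->|ij] := eqVneq i j; first by rewrite bminor_diag dhomog0.
have [s [<- <-]] := exists_perm2 ij; rewrite /p /bminor det_border_perm.
rewrite -signr_odd mulr_sign.
by case: ifP; rewrite ?dhomogN det_homog // => i' j'; rewrite mxE.
Qed.

Lemma bminor_koszul i j l : 'X_i * p j l - 'X_j * p i l + 'X_l * p i j = 0.
Proof.
have := det_border_koszul (delta_mx 0 j) (delta_mx 0 l) i Wx.
rewrite !mul_delta_var_col !mxE eqxx !mulr1n mulrC => pE.
by rewrite /p /bminor /= pE addrAC subrK subrr.
Qed.

(** By [bminor_koszul] the bivector is a Koszul cocycle. The two-index homotopy writes it as a
    coboundary after division by (k + 2 + k e) - 2 = k + k e, nonzero because [k] is positive. *)
Lemma exists_vector_field : [pchar F] =i pred0 -> (0 < k)%N -> exists X : 'cV[S]_k.+2,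
  (forall i, X i 0 \is (k * e).-1.-homog) /\
  (forall i j, p i j = 'X_i * X j 0 - 'X_j * X i 0).
Proof.
move=> F0 k_gt0; pose v j := \sum_i (p i j)^`M(i).
have nz : (k + k * e)%:R != 0 :> F by rewrite ((pcharf0P F).1 F0) -lt0n addn_gt0 k_gt0.
exists (\col_i ((k + k * e)%:R^-1 *: v i)); split=> [i|i j].
  by rewrite mxE rpredZ // rpred_sum // => j _; apply/mderiv_homog/bminor_homog.
have := koszul_homotopy2 bminor_homog bminor_antisym bminor_koszul i j.
rewrite -[(k.+2 + _)%N]/(2 + (k + k * e))%N natrD scalerDl scaler_nat => /addrI pE.
by rewrite !mxE -!scalerAr -scalerBr -pE scalerA mulVf // scale1r.
Qed.

End Fixed.
End DegeneracyIdeal.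

(** * Exactness and saturation when the minors contain a regular pair *)

Section CodimensionTwo.
Variables (F : fieldType) (k N : nat).
Local Notation S := {mpoly F[k.+2]}.
Local Notation x := (var_col F k).
Variables (W : 'M[S]_(k, k.+2)) (X : 'cV[S]_k.+2) (i0 i1 : 'I_k.+2) (G0 G1 : S).
Hypothesis F0 : [pchar F] =i pred0.
Hypothesis k_gt0 : (0 < k)%N.
Hypothesis Wx : W *m x = 0.
Hypothesis pX : forall i j, bminor W (i, j) = 'X_i * X j 0 - 'X_j * X i 0.
Hypothesis i01 : i0 != i1.
Hypothesis hG0 : restricts_to_power i0 i1 N i0 G0.
Hypothesis hG1 : restricts_to_power i0 i1 N i1 G1.
Hypothesis IG0 : ideal_gen (bminor W) G0.
Hypothesis IG1 : ideal_gen (bminor W) G1.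
Implicit Types (a : 'rV[S]_k.+2) (c : 'rV[S]_k).

Definition contract a : S := (a *m X) 0 0.

Lemma contractD a b : contract (a + b) = contract a + contract b.
Proof. by rewrite /contract (mulmxDl a) mxE. Qed.

Lemma contractB a b : contract (a - b) = contract a - contract b.
Proof. by rewrite /contract mulmxBl !mxE. Qed.

Lemma contractZ (q : S) a : contract (q *: a) = q * contract a.
Proof. by rewrite /contract -scalemxAl mxE. Qed.

Lemma G0_neq0 : G0 != 0.
Proof.
apply/eqP => G00; have [_ /(_ (U_(i0) *+ N)%MM)] := hG0.
rewrite G00 mcoeff0 eqxx off_line_pow ?eqxx // => /(_ erefl) /eqP.
by rewrite eq_sym oner_eq0.
Qed.

(** Expanding along [a] with p_jl = x_j X_l - x_l X_j, the second half collects the Euler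
    contraction of [a], which is zero. *)
Lemma border_contract a j : a *m x = 0 ->
  \det (border (delta_mx 0 j) a W) = 'X_j * contract a.
Proof.
move=> /eqP; rewrite mul_var_col => /eqP xa.
rewrite det_border_expand /contract mxE mulr_sumr.
under eq_bigr => l _ do rewrite -[\det _]/(bminor W (j, l)) pX mulrBr.
rewrite sumrB [X in _ - X](_ : _ = 0) ?subr0.
  by apply: eq_bigr => l _; rewrite mulrCA.
transitivity ((\sum_i 'X_i * a 0 i) * X j 0); last by rewrite xa mul0r.
by rewrite mulr_suml; apply: eq_bigr => l _; rewrite mulrA [a 0 l * _]mulrC.
Qed.

Lemma contract_span c : contract (c *m W) = 0.
Proof.
have rW r : contract (row r W) = 0.
  have : row r W *m x = 0 by rewrite -row_mul Wx row0.
  move=> /(border_contract i0); rewrite det_border_row => /esym/eqP.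
  by rewrite mulf_eq0 (negPf (mpolyX_neq0 _ _)) => /eqP.
rewrite mulmx_sum_row /contract mulmx_suml summxE big1 // => r _.
by rewrite -scalemxAl mxE -/(contract _) rW mulr0.
Qed.

Lemma span_free c : c *m W = 0 -> c = 0.
Proof.
move=> cW; have G0c : G0 *: c = 0.
  have [h ->] := IG0; rewrite scaler_suml big1 // => ij _.
  by rewrite -scalerA /bminor det_border_free // scaler0.
by move/eqP: G0c; rewrite scalemx_eq0 (negPf G0_neq0) => /eqP.
Qed.

(** Cramer's rule puts each minor times [a] in the span of the rows, because both determinants
    bordered by [a] are multiples of [contract a]. *)
Lemma ideal_mul_span g a : ideal_gen (bminor W) g -> a *m x = 0 -> contract a = 0 ->
  exists c, g *: a = c *m W.
Proof.
move=> [h ->] ax fa; have ya j : \det (border (delta_mx 0 j) a W) = 0.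
  by rewrite border_contract // fa mulr0.
rewrite scaler_suml; apply: (big_ind (fun v => exists c, v = c *m W)).
- by exists 0; rewrite mul0mx.
- by move=> _ _ [c ->] [d ->]; exists (c + d); rewrite mulmxDl.
move=> ij _; have [c eq_c] := det_border_cramer (ya ij.1) (ya ij.2).
by exists (h ij *: c); rewrite -scalerA eq_c scalemxAl.
Qed.

(* By Cramer's rule a is a combination of the rows of W with coefficients having
   denominator G0 or G1; these denominators form a regular sequence. *)
Lemma contract_ker a : a *m x = 0 -> contract a = 0 -> exists c, a = c *m W.
Proof.
move=> ax fa; have [c eq_c] := ideal_mul_span IG0 ax fa.
have [d eq_d] := ideal_mul_span IG1 ax fa.
have eq_cd : G1 *: c = G0 *: d.
  apply/eqP; rewrite -subr_eq0; apply/eqP/span_free.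
  by rewrite mulmxBl -!scalemxAl -eq_c -eq_d !scalerA mulrC subrr.
have /fin_all_exists [b eq_b] : forall r, exists q, c 0 r = q * G0.
  move=> r; apply: (@regular_pair _ _ i0 i1 N i01 G0 G1 _ (d 0 r)) => //.
  by have /rowP/(_ r) := eq_cd; rewrite !mxE mulrC [_ * d 0 r]mulrC.
exists (\row_r b r); apply/eqP; rewrite -subr_eq0.
have : G0 *: (a - (\row_r b r) *m W) = 0.
  rewrite scalerBr eq_c scalemxAl; apply/eqP; rewrite subr_eq0; apply/eqP.
  by congr (_ *m W); apply/rowP => r; rewrite !mxE mulrC -eq_b.
by move/eqP; rewrite scalemx_eq0 (negPf G0_neq0).
Qed.

(** By Koszul exactness [a] comes from an antisymmetric array [b], and its contraction is the sum of
    the b_ij x_i X_j, that is half the sum of the b_ij p_ij over ordered pairs. *)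
Lemma contract_ideal a : a *m x = 0 -> ideal_gen (bminor W) (contract a).
Proof.
move=> /eqP; rewrite mul_var_col => /eqP /(koszul_exact F0) [b [bN ab]].
have two_nz : 2%:R != 0 :> F by rewrite ((pcharf0P F).1 F0).
exists (fun ij => 2%:R^-1 *: b ij.1 ij.2).
apply: (can_inj (scalerK two_nz)); rewrite scaler_sumr.
under eq_bigr => ij _ do rewrite -scalerAl scalerA mulfV // scale1r.
rewrite -(pair_bigA _ (fun i j => b i j * bminor W (i, j))) /=.
under eq_bigr => i _ do under eq_bigr => j _ do rewrite pX mulrBr.
under eq_bigr => i _ do rewrite sumrB.
have fE : contract a = \sum_i \sum_j b i j * ('X_i * X j 0).
  rewrite /contract mxE exchange_big /=; apply: eq_bigr => j _.
  by rewrite ab mulr_suml; apply: eq_bigr => i _; rewrite mulrA [b i j * _]mulrC.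
rewrite sumrB -fE [X in _ - X](_ : _ = - contract a).
  by rewrite opprK scaler_nat mulr2n.
rewrite fE exchange_big -sumrN; apply: eq_bigr => i _; rewrite -sumrN.
by apply: eq_bigr => j _; rewrite bN mulNr.
Qed.

Definition radial (i j : 'I_k.+2) : 'rV[S]_k.+2 :=
  'X_i *: delta_mx 0 j - 'X_j *: delta_mx 0 i.

Lemma radial_var_col i j : radial i j *m x = 0.
Proof.
rewrite /radial mulmxBl -!scalemxAl !mul_delta_var_col !scale_scalar_mx mulrC.
by rewrite subrr.
Qed.

Lemma contract_radial i j : contract (radial i j) = bminor W (i, j).
Proof.
by rewrite contractB !contractZ pX /contract -!rowE !mxE.
Qed.

Lemma ideal_contract g : ideal_gen (bminor W) g ->
  exists a, a *m x = 0 /\ g = contract a.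
Proof.
move=> [h ->]; apply: (big_ind (fun g => exists a, a *m x = 0 /\ g = contract a)).
- by exists 0; rewrite mul0mx /contract mul0mx mxE.
- move=> _ _ [a [ax ->]] [b [bx ->]]; exists (a + b); rewrite mulmxDl ax bx addr0.
  by rewrite contractD.
move=> ij _; exists (h ij *: radial ij.1 ij.2).
rewrite -scalemxAl radial_var_col scaler0 contractZ contract_radial.
by split; last by case: ij.
Qed.

(** A chase through 0 -> S^k -> M -> I -> 0 with powers of three variables: lift each x_i^n h to M,
    correct the lift for x_i0 by a row combination so that it becomes divisible by x_i0^n, and
    contract the quotient. *)
Lemma ideal_saturated h : saturation (ideal_gen (bminor W)) h ->
  ideal_gen (bminor W) h.
Proof.
(* A third variable exists because [k] is positive. *)
have /card_gt0P [i2] : (0 < #|~: [set i0; i1]|)%N.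
  by rewrite cardsCs finset.setCK cards2 card_ord i01 subn_gt0 ltnS.
rewrite !inE negb_or => /andP [i20 i21].
move=> [n hn]; pose P i : S := 'X_[U_(i) *+ n].
have /fin_all_exists [a ha] : forall i, exists a, a *m x = 0 /\ P i * h = contract a.
  by move=> i; apply/ideal_contract/hn; rewrite mdegMn mdeg1 mul1n.
have ax i : a i *m x = 0 by case: (ha i).
have fa i : contract (a i) = P i * h by case: (ha i).
have /fin_all_exists [b hb] : forall ij : 'I_k.+2 * 'I_k.+2, exists c,
    P ij.2 *: a ij.1 - P ij.1 *: a ij.2 = c *m W.
  move=> [i j] /=; apply: contract_ker.
    by rewrite mulmxBl -!scalemxAl !ax !scaler0 subrr.
  by rewrite contractB !contractZ !fa mulrCA subrr.
(* The differences of the lifts satisfy the cocycle relation on three indices; it splits b_01 along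
   x_i1^n and x_i0^n. *)
have cocycle : P i2 *: b (i0, i1) = P i1 *: b (i0, i2) + P i0 *: - b (i1, i2).
  apply/eqP; rewrite -subr_eq0; apply/eqP/span_free.
  rewrite mulmxBl mulmxDl -!scalemxAl mulNmx -!hb /=; apply/rowP => j.
  by rewrite !mxE; ring.
have /fin_all_exists [cd hcd] : forall r, exists cd : S * S,
    b (i0, i1) 0 r = P i1 * cd.1 + P i0 * cd.2.
  move=> r; have /rowP/(_ r) := cocycle; rewrite !mxE => /monomial_colon.
  by move=> /(_ i21 i20) [c [d eq_b]]; exists (c, d).
pose c := \row_r (cd r).1; pose d := \row_r (cd r).2.
have bE : b (i0, i1) = P i1 *: c + P i0 *: d by apply/rowP => r; rewrite !mxE hcd.
have eq_a : P i1 *: (a i0 - c *m W) = P i0 *: (a i1 + d *m W).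
  have swap (V : zmodType) (p q r t : V) : p - q = r + t -> p - r = q + t.
    move=> pq; rewrite -[p](subrK q) pq addrAC [r + t]addrC addrK addrC //.
  rewrite scalerBr scalerDr !scalemxAl; apply: swap.
  by rewrite -mulmxDl -bE -hb.
have /fin_all_exists [u hu] : forall j, exists q, (a i0 - c *m W) 0 j = P i0 * q.
  move=> j; have /rowP/(_ j) := eq_a; rewrite mxE [RHS]mxE => /monomial_regular.
  by apply; rewrite eq_sym.
have aE : a i0 - c *m W = P i0 *: \row_j u j by apply/rowP => j; rewrite hu !mxE.
have P0 : P i0 != 0 by apply: mpolyX_neq0.
have -> : h = contract (\row_j u j).
  by apply: (mulfI P0); rewrite -contractZ -aE contractB contract_span subr0 fa.
apply: contract_ideal; have : P i0 *: ((\row_j u j) *m x) = 0.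
  by rewrite scalemxAl -aE mulmxBl ax -mulmxA Wx mulmx0 subrr.
by move/eqP; rewrite scalemx_eq0 (negPf P0) => /eqP.
Qed.

End CodimensionTwo.

Section Resolution.
Variables (F : fieldType) (k e : nat).
Local Notation S := {mpoly F[k.+2]}.
Local Notation x := (var_col F k).

(* The rows of W and the contraction with X form a resolution
   0 -> S^k -> M -> I -> 0, where M is the module of forms killed by the radial
   field and I is the ideal of maximal minors of W, which is saturated. *)
Record resolves (W : 'M[S]_(k, k.+2)) (X : 'cV[S]_k.+2) : Prop := Resolves {
  rows_homog : forall i j, W i j \is e.-homog;
  rows_var_col : W *m x = 0;
  field_homog : forall i, X i 0 \is (k * e).-1.-homog;
  bminor_field : forall i j, bminor W (i, j) = 'X_i * X j 0 - 'X_j * X i 0;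
  rows_free : forall c : 'rV[S]_k, c *m W = 0 -> c = 0;
  rows_contract : forall c : 'rV[S]_k, contract X (c *m W) = 0;
  contract_exact : forall a : 'rV[S]_k.+2, a *m x = 0 -> contract X a = 0 ->
    exists c, a = c *m W;
  contract_image : forall g, ideal_gen (bminor W) g <->
    exists a : 'rV[S]_k.+2, a *m x = 0 /\ g = contract X a;
  minors_neq0 : exists ij, bminor W ij != 0;
  minors_saturated : forall g, saturation (ideal_gen (bminor W)) g ->
    ideal_gen (bminor W) g
}.

Lemma codim2_resolves (W : 'M[S]_(k, k.+2)) N i0 i1 (G0 G1 : S) :
    [pchar F] =i pred0 -> (0 < k)%N ->
    (forall i j, W i j \is e.-homog) -> W *m x = 0 -> i0 != i1 ->
    restricts_to_power i0 i1 N i0 G0 -> restricts_to_power i0 i1 N i1 G1 ->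
    ideal_gen (bminor W) G0 -> ideal_gen (bminor W) G1 ->
  exists X, resolves W X.
Proof.
move=> F0 k0 hW Wx i01 hG0 hG1 IG0 IG1.
have [X [hX pX]] := exists_vector_field hW Wx F0 k0.
exists X; split=> // [c|c|a|g||g].
- exact: (span_free hG0 IG0).
- exact: (contract_span i0 Wx pX).
- exact: (contract_ker pX i01 hG0 hG1 IG0 IG1).
- split=> [|[a [ax ->]]]; first exact: ideal_contract.
  exact: contract_ideal.
- apply/existsP; apply: contraNT (G0_neq0 hG0); rewrite negb_exists => /forallP p0.
  by have [h ->] := IG0; rewrite big1 // => ij _; rewrite (eqP (negbNE (p0 ij))) mulr0.
exact: (ideal_saturated F0 k0 Wx pX i01 hG0 hG1 IG0 IG1).
Qed.

End Resolution.

(** * Hilbert polynomial *)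

Section WedgeMinors.
Variables (F : fieldType) (k e : nat).
Local Notation S := {mpoly F[k.+2]}.

Definition form_row t (a : cone_form F k.+1 t) : 'rV[S]_k.+2 := \row_i (a i : S).

Definition form_mx (w : k.-tuple (cone_form F k.+1 e)) : 'M[S]_(k, k.+2) :=
  \matrix_(r, i) (tnth w r i : S).

Lemma wedge_coef_homog w J : @wedge_coef F k.+1 e k w J \is (k * e).-homog.
Proof. by apply: det_homog => i j; rewrite mxE dhomog_is_dhomog. Qed.

Lemma wedge_coef_bminor w (s : 'S_k.+2) :
  bminor (form_mx w) (s (top0 k), s (top1 k)) =
    (-1) ^+ s * wedge_coef w [ffun r => s (below r)].
Proof.
rewrite /bminor det_border_perm; congr (_ * \det _).
by apply/matrixP => i j; rewrite !mxE ffunE.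
Qed.

Lemma wedge_coef_noninj w (J : {ffun 'I_k -> 'I_k.+2}) :
  ~~ injectiveb J -> @wedge_coef F k.+1 e k w J = 0.
Proof.
move=> /injectivePn [i [j ij Jij]]; rewrite /wedge_coef -det_tr.
by apply: (determinant_alternate ij) => r; rewrite !mxE Jij.
Qed.

(** The image of [J] misses exactly two indices; they fill the two top positions. *)
Lemma exists_perm_below (J : {ffun 'I_k -> 'I_k.+2}) : injective J ->
  exists s : 'S_k.+2, forall r, s (below r) = J r.
Proof.
move=> injJ; have : #|~: [set J r | r in 'I_k]| == 2%N.
  by rewrite cardsCs finset.setCK card_imset // !card_ord -addn2 addKn.
move=> /cards2P [a [b [ab imJ]]].
have notJ r : (J r == a) = false /\ (J r == b) = false.
  have : J r \notin [set a; b] by rewrite -imJ inE negbK imset_f.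
  by rewrite !inE negb_or => /andP [/negPf -> /negPf ->].
pose g i := if unlift ord0 i is Some i' then
  (if unlift ord0 i' is Some r then J r else b) else a.
have g0 : g (top0 k) = a.
  by rewrite /g (_ : top0 k = ord0) ?unlift_none //; apply: val_inj.
have g1 : g (top1 k) = b.
  rewrite /g (_ : top1 k = lift ord0 ord0) ?liftK ?unlift_none //; exact: val_inj.
have g2 r : g (below r) = J r.
  rewrite /g (_ : below r = lift ord0 (lift ord0 r)) ?liftK //; exact: val_inj.
have injg : injective g.
  move=> i j; case: (row_specP i) => [||r]; case: (row_specP j) => [||r'] //;
    rewrite ?g0 ?g1 ?g2.
  - by move/eqP; rewrite (negPf ab).
  - by move/eqP; rewrite eq_sym (notJ _).1.
  - by move/eqP; rewrite eq_sym (negPf ab).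
  - by move/eqP; rewrite eq_sym (notJ _).2.
  - by move/eqP; rewrite (notJ _).1.
  - by move/eqP; rewrite (notJ _).2.
  by move/injJ ->.
by exists (perm injg) => r; rewrite permE g2.
Qed.

(** Both families consist of the maximal minors up to sign, and of zeros coming from a repeated
    column or a repeated border row. *)
Lemma ideal_gen_wedge w :
  ideal_gen (@wedge_coef F k.+1 e k w) = ideal_gen (bminor (form_mx w)).
Proof.
apply/seteqP; split; [apply: ideal_gen_sub => J | apply: ideal_gen_sub => -[i j]].
  have [g0 _ gM gg] := ideal_genMn (bminor (form_mx w)).
  have [/injectiveP injJ|/wedge_coef_noninj -> //] := boolP (injectiveb J).
  have [s sJ] := exists_perm_below injJ.
  have -> : J = [ffun r => s (below r)] by apply/ffunP => r; rewrite ffunE sJ.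
  have := wedge_coef_bminor w s => /(congr1 ( *%R ((-1) ^+ s))).
  by rewrite mulrA -signr_addb addbb mul1r => <-; apply: gM.
have [g0 _ gM gg] := ideal_genMn (@wedge_coef F k.+1 e k w).
have [->|/exists_perm2 [s [<- <-]]] := eqVneq i j; first by rewrite bminor_diag.
by rewrite wedge_coef_bminor; apply: gM.
Qed.

Lemma mem_H0Omega1_row t (a : cone_form F k.+1 t) :
  (a \in H0Omega1 F k.+1 t.+1) = (form_row a *m var_col F k == 0).
Proof.
apply: etrans (@mem_H0Omega1 F k.+1 t.+1 a) _; rewrite mul_var_col.
by congr (_ == 0); apply: eq_bigr => i _; rewrite mxE.
Qed.

End WedgeMinors.

Section HilbertPolynomial.
Variable F : fieldType.
Hypothesis F0 : [pchar F] =i pred0.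

(** Induction through (n+1) C(d+n+1, n+1) = (d+n+1) C(d+n, n). *)
Lemma binomial_poly n : exists b : {poly rat}, forall d : nat, b.[d%:R] = ('C(d + n, d))%:R.
Proof.
elim: n => [|n [b hb]].
  by exists 1 => d; rewrite hornerE addn0 binn.
exists (n.+1%:R^-1 *: (b * ('X + n.+1%:R%:P))) => d.
rewrite hornerZ hornerM hornerD hornerX hornerC hb.
have nz : n.+1%:R != 0 :> rat by rewrite pnatr_eq0.
apply: (canLR (mulKf nz)).
rewrite -natrD -!natrM; congr (_%:R).
rewrite -(@bin_sub (d + n.+1) d) ?leq_addr // -(@bin_sub (d + n) d) ?leq_addr //.
by rewrite !addKn addnS -mul_bin_diag mulnC.
Qed.

Variables (k e : nat).
Local Notation S := {mpoly F[k.+2]}.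
Local Notation x := (var_col F k).

Lemma dim_dhomog d : \dim {: dhomog k.+2 F d} = 'C(d + k.+1, d).
Proof. exact: dimvf. Qed.

(** The Euler contraction is onto the polynomials of degree t + 1: by Euler's identity the partial
    derivatives of [p], divided by t + 1, form a preimage. *)
Lemma dim_H0Omega1 t :
  (\dim (H0Omega1 F k.+1 t.+1) + 'C(t.+1 + k.+1, t.+1) = k.+2 * 'C(t + k.+1, t))%N.
Proof.
have := limg_ker_dim (linfun (@euler F k.+1 t)) fullv.
rewrite capfv => dimE; rewrite -[RHS](_ : \dim {: cone_form F k.+1 t} = _).
  rewrite -dimE; congr (_ + _)%N; rewrite -dim_dhomog; congr (\dim _).
  apply/vspaceP => p; rewrite memvf; apply/esym/memv_imgP.
  have hp : (p : S) \is t.+1.-homog by apply: dhomog_is_dhomog.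
  have hd i : t.+1%:R^-1 *: (p : S)^`M(i) \is t.-homog by apply/rpredZ/(mderiv_homog i hp).
  exists [ffun i => DHomog (hd i)]; first exact: memvf.
  rewrite lfunE; apply: (@val_inj _ _ (dhomog k.+2 F t.+1)) => /=.
  under eq_bigr => i _ do rewrite ffunE /= -scalerAr.
  rewrite -scaler_sumr (euler_identity hp) scalerA mulVf ?scale1r //.
  by rewrite ((pcharf0P F).1 F0).
by rewrite dimvf; transitivity (#|'I_k.+2| * 'C(t + k.+1, t))%N => //; rewrite card_ord.
Qed.

End HilbertPolynomial.

(** * Graded pieces of the resolution *)

Section GradedPieces.
Variables (F : fieldType) (k e : nat).
Local Notation S := {mpoly F[k.+2]}.
Local Notation x := (var_col F k).

Lemma contract_homog t d (X : 'cV[S]_k.+2) (a : 'rV[S]_k.+2) :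
    (forall i, a 0 i \is t.-homog) -> (forall i, X i 0 \is d.-homog) ->
  contract X a \is (t + d).-homog.
Proof. by move=> ha hX; rewrite /contract mxE rpred_sum // => i _; rewrite dhomogM. Qed.

Lemma mulmx_pihomog m m' t d (a : 'rV[S]_m) (B : 'M[S]_(m, m')) :
    (forall i j, B i j \is d.-homog) ->
  map_mx (pihomog mdeg (t + d)) (a *m B) = map_mx (pihomog mdeg t) a *m B.
Proof.
move=> hB; apply/rowP => j; rewrite !mxE raddf_sum /=; apply: eq_bigr => i _.
by rewrite mxE mulrC [(t + d)%N]addnC (pihomog_mul _ _ (hB i j)) mulrC.
Qed.

Lemma mulmx_pihomog_lt m m' t d (a : 'rV[S]_m) (B : 'M[S]_(m, m')) :
    (forall i j, B i j \is d.-homog) -> (t < d)%N ->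
  map_mx (pihomog mdeg t) (a *m B) = 0.
Proof.
move=> hB td; apply/rowP => j; rewrite !mxE raddf_sum big1 //= => i _.
by rewrite mulrC (pihomog_mul_lt _ (hB i j) td).
Qed.

Lemma map_pihomog_dE m t (a : 'rV[S]_m) : (forall i, a 0 i \is t.-homog) ->
  map_mx (pihomog mdeg t) a = a.
Proof. by move=> ha; apply/rowP => i; rewrite mxE pihomog_dE. Qed.

Lemma var_col_homog i j : x i j \is 1.-homog.
Proof. by rewrite mxE dhomogX /= mdeg1. Qed.

Lemma pihomog_var_col t (a : 'rV[S]_k.+2) : a *m x = 0 ->
  map_mx (pihomog mdeg t) a *m x = 0.
Proof.
move=> ax; rewrite -(mulmx_pihomog t a var_col_homog) ax.
by apply/rowP => i; rewrite !mxE raddf0.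
Qed.

Section Resolved.
Variables (W : 'M[S]_(k, k.+2)) (X : 'cV[S]_k.+2).
Hypothesis HW : resolves e W X.
Let D := (k * e).-1.

Lemma contract_image_homog t g : g \is (t + D).-homog ->
  (ideal_gen (bminor W) g <->
   exists a : 'rV[S]_k.+2, [/\ forall i, a 0 i \is t.-homog, a *m x = 0 & g = contract X a]).
Proof.
move=> hg; rewrite (contract_image HW); split=> [[a [ax gE]]|[a [_ ax gE]]]; last by exists a.
exists (map_mx (pihomog mdeg t) a); split; first by move=> i; rewrite mxE pihomogP.
  exact: pihomog_var_col.
have hX i j : X i j \is D.-homog by rewrite [j]ord1; exact: field_homog HW i.
by rewrite /contract -(mulmx_pihomog _ _ hX) mxE -/(contract X a) -gE pihomog_dE.
Qed.

Lemma contract_exact_homog s (a : 'rV[S]_k.+2) :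
    (forall i, a 0 i \is (s + e).-homog) -> a *m x = 0 -> contract X a = 0 ->
  exists c : 'rV[S]_k, (forall r, c 0 r \is s.-homog) /\ a = c *m W.
Proof.
move=> ha ax fa; have [c ac] := contract_exact HW ax fa.
exists (map_mx (pihomog mdeg s) c); split; first by move=> r; rewrite mxE pihomogP.
by rewrite -(mulmx_pihomog _ _ (rows_homog HW)) -ac map_pihomog_dE.
Qed.

Lemma contract_exact_lt t (a : 'rV[S]_k.+2) : (t < e)%N ->
    (forall i, a 0 i \is t.-homog) -> a *m x = 0 -> contract X a = 0 -> a = 0.
Proof.
move=> te ha ax fa; have [c ac] := contract_exact HW ax fa.
by rewrite -(map_pihomog_dE ha) ac (mulmx_pihomog_lt _ (rows_homog HW)).
Qed.

End Resolved.

Lemma closed_subscheme_minors w X : resolves e (@form_mx F k e w) X ->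
  closed_subscheme (ideal_gen (bminor (form_mx w))).
Proof.
move=> HW; have [g0 gD gM _] := ideal_genMn (bminor (form_mx w)).
split=> //; last exact: minors_saturated HW.
by move=> f d; rewrite -ideal_gen_wedge; apply/ideal_gen_pihomog/wedge_coef_homog.
Qed.

Section HilbertFunction.
Variables (w : k.-tuple (cone_form F k.+1 e)) (X : 'cV[S]_k.+2).
Hypothesis HW : resolves e (form_mx w) X.
Let D := (k * e).-1.
Variable s : nat.
Local Notation t := (s + e)%N.

Lemma form_row_homog (a : cone_form F k.+1 t) i : form_row a 0 i \is t.-homog.
Proof. by rewrite mxE dhomog_is_dhomog. Qed.

Definition contract_form (a : cone_form F k.+1 t) : dhomog k.+2 F (t + D) :=
  DHomog (contract_homog (form_row_homog a) (field_homog HW)).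

Lemma contract_form_linear : linear contract_form.
Proof.
move=> c a b; apply: val_inj; rewrite /= /contract !mxE scaler_sumr -big_split.
by apply: eq_bigr => i _; rewrite !mxE !ffunE /= mulrDl scalerAl.
Qed.

HB.instance Definition _ := GRing.isLinear.Build F (cone_form F k.+1 t)
  (dhomog k.+2 F (t + D)) _ contract_form contract_form_linear.

Lemma combination_homog (c : {ffun 'I_k -> dhomog k.+2 F s}) i :
  ((\row_r (c r : S)) *m form_mx w) 0 i \is t.-homog.
Proof.
rewrite mxE rpred_sum // => r _; rewrite dhomogM ?mxE ?dhomog_is_dhomog //.
Qed.

Definition combination (c : {ffun 'I_k -> dhomog k.+2 F s}) : cone_form F k.+1 t :=
  [ffun i => DHomog (combination_homog c i)].

Lemma combination_linear : linear combination.
Proof.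
move=> a c d; apply/ffunP => i; apply: val_inj.
rewrite !ffunE /= !mxE scaler_sumr -big_split; apply: eq_bigr => r _.
by rewrite !mxE !ffunE /= mulrDl scalerAl.
Qed.

HB.instance Definition _ := GRing.isLinear.Build F {ffun 'I_k -> dhomog k.+2 F s}
  (cone_form F k.+1 t) _ combination combination_linear.

Lemma form_row_combination c : form_row (combination c) = (\row_r (c r : S)) *m form_mx w.
Proof. by apply/rowP => i; rewrite [LHS]mxE ffunE. Qed.

(** By exactness the kernel is the image of k-tuples of polynomials of degree [s], injectively since
    the rows are free. *)
Lemma dim_ker_contract :
  \dim (H0Omega1 F k.+1 t.+1 :&: lker (linfun contract_form)) = (k * 'C(s + k.+1, s))%N.
Proof.
have -> : (H0Omega1 F k.+1 t.+1 :&: lker (linfun contract_form))%VS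
          = limg (linfun combination).
  apply/vspaceP => a; rewrite memv_cap mem_H0Omega1_row memv_ker lfunE.
  apply/idP/memv_imgP => [/andP [/eqP ax /eqP fa]|[c _ ->]].
    have {}fa : contract X (form_row a) = 0 by have := congr1 val fa.
    have [c [hc ac]] := contract_exact_homog HW (form_row_homog a) ax fa.
    exists [ffun r => DHomog (hc r)]; first exact: memvf.
    rewrite lfunE; apply/ffunP => i; apply: val_inj.
    have /rowP/(_ i) := ac; rewrite mxE => aE; apply: etrans aE _; rewrite ffunE /=.
    by congr ((_ *m _) 0 i); apply/rowP => r; rewrite mxE ffunE.
  rewrite lfunE /= form_row_combination -mulmxA (rows_var_col HW) mulmx0 eqxx /=.
  apply/eqP/val_inj; rewrite /= form_row_combination; exact: rows_contract HW _.
rewrite limg_dim_eq; last first.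
  apply/eqP; rewrite -subv0; apply/subvP => c; rewrite memv_cap memvf memv_ker lfunE /=.
  move=> /eqP c0; rewrite memv0; apply/eqP/ffunP => r; rewrite ffunE; apply: val_inj.
  have cW : (\row_r (c r : S)) *m form_mx w = 0.
    by rewrite -form_row_combination c0; apply/rowP => i; rewrite !mxE ffunE.
  by have /rowP/(_ r) := rows_free HW cW; rewrite !mxE.
by rewrite dimvf; transitivity (#|'I_k| * 'C(s + k.+1, s))%N => //; rewrite card_ord.
Qed.

(** Rank-nullity for the contraction, whose image on M_t is the piece of I in degree t + D. *)
Lemma hilbert_piece : exists I_d : {vspace dhomog k.+2 F (t + D)},
  (forall f : dhomog k.+2 F (t + D), f \in I_d <-> ideal_gen (bminor (form_mx w)) (f : S)) /\
  (k * 'C(s + k.+1, s) + \dim I_d = \dim (H0Omega1 F k.+1 t.+1))%N.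
Proof.
exists (linfun contract_form @: H0Omega1 F k.+1 t.+1)%VS; split=> [f|]; last first.
  by rewrite -dim_ker_contract limg_ker_dim.
rewrite (contract_image_homog HW (dhomog_is_dhomog f)); split.
  move=> /memv_imgP [a]; rewrite mem_H0Omega1_row => /eqP ax ->; rewrite lfunE.
  by exists (form_row a); split=> //; exact: form_row_homog.
move=> [a [ha ax fE]]; apply/memv_imgP; exists [ffun i => DHomog (ha i)].
  rewrite mem_H0Omega1_row -ax; apply/eqP; congr (_ *m _).
  by apply/rowP => i; rewrite mxE ffunE.
rewrite lfunE; apply: val_inj; rewrite /= fE; congr contract.
by apply/rowP => i; rewrite mxE ffunE.
Qed.

End HilbertFunction.
End GradedPieces.

Lemma exists_hilbert_poly (F : fieldType) k e : [pchar F] =i pred0 ->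
  exists P : {poly rat}, forall (w : k.-tuple (cone_form F k.+1 e)) X,
    resolves e (form_mx w) X -> has_hilbert_poly (ideal_gen (bminor (form_mx w))) P.
Proof.
move=> F0; have [b hb] := binomial_poly k.+1; pose D := (k * e).-1.
(* With t = d - D, [b] at d is dim S_d, and the bracket is dim I_d = dim M_t - k dim S_(t-e), where
   dim M_t = (k+2) dim S_t - dim S_(t+1). *)
exists (b - (k.+2%:R *: (b \Po ('X - D%:R%:P)) - (b \Po ('X - D%:R%:P + 1%:P))
             - k%:R *: (b \Po ('X - D%:R%:P - e%:R%:P)))) => w X HW.
exists (e + D)%N => d le_d; have -> : d = ((d - (e + D)) + e + D)%N by lia.
move: (d - (e + D))%N => s; have [I_d [hI dimI]] := hilbert_piece HW s.
exists I_d; split=> //; have dimM := dim_H0Omega1 F0 k (s + e).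
rewrite !(hornerD, hornerN, hornerZ, horner_comp, hornerX, hornerC).
have tE : (s + e + D)%:R - D%:R = (s + e)%:R :> rat by rewrite [in LHS]natrD addrK.
have sE : (s + e)%:R - e%:R = s%:R :> rat by rewrite natrD addrK.
rewrite hb dim_dhomog !tE sE natr1 !hb; congr (_ - _).
rewrite -natrM -dimM -dimI -natrM !natrD; ring.
Qed.

(** * Recovering the forms from the ideal *)

Lemma row_combinationE (R : comNzRingType) n (a b c : R) (A B C D : 'rV[R]_n) m r :
  (A *+ m + (a *: B - b *: C + c *: D)) 0 r =
    A 0 r *+ m + (a * B 0 r - b * C 0 r + c * D 0 r).
Proof. by rewrite mxE mulmxnE !mxE. Qed.

Lemma row_combination4E (R : comNzRingType) n (a b c d : R) (A B C D : 'rV[R]_n) r :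
  (a *: A - b *: B + c *: C - d *: D) 0 r =
    a * A 0 r - b * B 0 r + c * C 0 r - d * D 0 r.
Proof. by rewrite !mxE. Qed.

Lemma row_mulrnBE (R : comNzRingType) n (A B : 'rV[R]_n) m r :
  (A *+ m - B) 0 r = A 0 r *+ m - B 0 r.
Proof. by rewrite mxE mulmxnE !mxE. Qed.

Lemma scaler_mul_swap (K : comNzRingType) (A : algType K) (a b : K) (p p' q : A) :
  a *: p' = b *: p -> b *: (q * p) = a *: (q * p').
Proof. by move=> ab; rewrite !scalerAr ab. Qed.

Lemma mulmxMnl (R : comNzRingType) n p q (A : 'M[R]_(n, p)) (B : 'M[R]_(p, q)) m :
  (A *+ m) *m B = (A *m B) *+ m.
Proof. by rewrite -!scaler_nat -scalemxAl. Qed.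

(** * The Koszul differential on two-index arrays of rows *)

Section KoszulDifferential.
Variables (R : comNzRingType) (n m : nat) (x : 'I_n -> R) (t : 'I_n -> 'I_n -> 'rV[R]_m).

Definition koszul_d i j l : 'rV[R]_m := x i *: t j l - x j *: t i l + x l *: t i j.

Lemma koszul_dd i j l h :
  x i *: koszul_d j l h - x j *: koszul_d i l h + x l *: koszul_d i j h
    - x h *: koszul_d i j l = 0.
Proof. by apply/rowP => r; rewrite !mxE; ring. Qed.

Lemma koszul_dE i j l r :
  koszul_d i j l 0 r = x i * t j l 0 r - x j * t i l 0 r + x l * t i j 0 r.
Proof. by rewrite !mxE. Qed.

Lemma koszul_d_mulmx p (B : 'M_(m, p)) i j l :
  (forall i j, t i j *m B = 0) -> koszul_d i j l *m B = 0.
Proof. by move=> tB; rewrite mulmxDl mulmxBl -!scalemxAl !tB !scaler0 subrr addr0. Qed.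

Lemma koszul_d_mulmxE p (B : 'M_(m, p)) i j l r : (koszul_d i j l *m B) 0 r =
  x i * (t j l *m B) 0 r - x j * (t i l *m B) 0 r + x l * (t i j *m B) 0 r.
Proof. by rewrite mulmxDl mulmxBl -!scalemxAl !mxE. Qed.

Hypothesis tN : forall i j, t i j = - t j i.

Lemma koszul_dN12 i j l : koszul_d i j l = - koszul_d j i l.
Proof. by rewrite /koszul_d (tN i j) scalerN opprD opprB. Qed.

Lemma koszul_dN23 i j l : koszul_d i j l = - koszul_d i l j.
Proof.
rewrite /koszul_d (tN j l) scalerN; by apply/rowP => r; rewrite !mxE; ring.
Qed.

End KoszulDifferential.

Lemma koszul_d_mulrnB (R : comNzRingType) n p q (x : 'I_n -> R)
    (t : 'I_n -> 'I_n -> 'rV[R]_p) (w : 'I_n -> 'I_n -> 'rV[R]_q) (B : 'M[R]_(q, p)) m i j l :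
  koszul_d x (fun i j => t i j *+ m - w i j *m B) i j l =
    koszul_d x t i j l *+ m - koszul_d x w i j l *m B.
Proof.
rewrite /koszul_d mulmxDl mulmxBl -!scalemxAl.
move: (w j l *m B) (w i l *m B) (w i j *m B) => u1 u2 u3.
by apply/rowP => r; rewrite !(mxE, mulmxnE); ring.
Qed.

Section Recovery.
Variables (F : fieldType) (k e : nat).
Hypothesis F0 : [pchar F] =i pred0.
Local Notation S := {mpoly F[k.+2]}.
Local Notation x := (var_col F k).

Lemma scaler_nat_eq0 (V : lmodType F) m (v : V) : (0 < m)%N -> m%:R *: v = 0 -> v = 0.
Proof.
move=> m0 /eqP; rewrite scaler_eq0 ((pcharf0P F).1 F0) => /orP [|/eqP //].
by rewrite eqn0Ngt m0.
Qed.

Lemma mderiv_const (q : S) i : q \is 0.-homog -> q^`M(i) = 0.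
Proof. by move/dhomog0_const ->; rewrite mderivC. Qed.

Lemma const_row_eq0 (v : 'rV[S]_k.+2) :
  (forall i, v 0 i \is 0.-homog) -> v *m x = 0 -> v = 0.
Proof.
move=> hv /eqP; rewrite mul_var_col => /eqP xv; apply/rowP => j.
rewrite -[LHS]scale1r -[1]/(1%:R) (koszul_syzygy hv xv) mxE big1 // => i _.
by rewrite !mderiv_const // subrr mulr0.
Qed.

(* The forms radial i j generate M with the Koszul relations between them: this
   says that every endomorphism of Omega^1 is a scalar. *)
Lemma radial_rigid (t : 'I_k.+2 -> 'I_k.+2 -> 'rV[S]_k.+2) :
    (forall i j l, t i j 0 l \is 1.-homog) -> (forall i j, t i j = - t j i) ->
    (forall i j, t i j *m x = 0) ->
    (forall i j l, 'X_i *: t j l - 'X_j *: t i l + 'X_l *: t i j = 0) ->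
  exists lam : F, forall i j, k.+1%:R%:MP *: t i j = lam%:MP *: radial F i j.
Proof.
move=> ht ta tx xt; pose v j : 'rV[S]_k.+2 := \row_l \sum_i (t i j 0 l)^`M(i).
have hv j l : v j 0 l \is 0.-homog.
  by rewrite mxE rpred_sum // => i _; apply: (mderiv_homog i (ht _ _ _)).
(* The two-index homotopy in degree 1: k + 2 + 1 = 2 + (k + 1). *)
have tE i j : k.+1%:R%:MP *: t i j = 'X_i *: v j - 'X_j *: v i.
  apply/rowP => l.
  have := @koszul_homotopy2 F k.+2 1 (fun i j => t i j 0 l) (fun i j => ht i j l) _ _ i j.
  have -> : (k.+2 + 1 = 2 + k.+1)%N by lia.
  rewrite natrD scalerDl scaler_nat => h; rewrite mxE mul_mpolyC.
  rewrite !mxE; apply/(@addrI _ (t i j 0 l *+ 2))/h => [i' j'|i' j' l'].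
    by rewrite ta mxE.
  by have /rowP/(_ l) := xt i' j' l'; rewrite !mxE.
(* Contracting [tE] with [x] gives a one-index cocycle, so the Euler contractions of the [v j] are
   one common scalar times the variables. *)
have [lam hlam] : exists lam : F, forall j, v j *m x = (lam%:MP * 'X_j)%:M.
  pose u j := (v j *m x) 0 0.
  have hu j : u j \is 1.-homog.
    rewrite /u mxE rpred_sum // => l _; exact: (dhomogM (hv j l) (var_col_homog F l 0)).
  have xu i j : 'X_i * u j = 'X_j * u i.
    have := congr1 (fun a => (a *m x) 0 0) (tE i j).
    rewrite /= -scalemxAl tx scaler0 mulmxBl -!scalemxAl !mxE => /esym/eqP.
    by rewrite subr_eq0 => /eqP; rewrite /u !mxE.
  have hs : \sum_i (u i)^`M(i) \is 0.-homog.
    by rewrite rpred_sum // => i _; apply: (mderiv_homog i (hu i)).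
  have uE := koszul_homotopy1 hu xu; rewrite (dhomog0_const hs) in uE.
  exists (k.+2%:R^-1 * (\sum_i (u i)^`M(i))@_0%MM) => j.
  apply/rowP => l; rewrite !ord1 -/(u j) mxE eqxx mulr1n.
  have nz : k.+2%:R != 0 :> F by rewrite ((pcharf0P F).1 F0).
  apply: (can_inj (scalerK nz)); rewrite -[RHS]mul_mpolyC mulrA -mpolyCM mulrA mulfV // mul1r.
  apply: (@addrI _ (u j)); rewrite [_ * 'X_j]mulrC -uE.
  by rewrite (natrD _ k.+2 1) [RHS]scalerDl [RHS]addrC; congr (_ + _); rewrite scale1r.
(* The difference of the two sides of [vE] is a form with constant coefficients killed by the Euler
   contraction, hence zero. *)
exists lam => i j; suff vE l : v l = lam%:MP *: delta_mx 0 l.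
  by rewrite tE !vE /radial scalerBr !scalerA ![lam%:MP * _]mulrC.
apply/eqP; rewrite -subr_eq0; apply/eqP/const_row_eq0 => [l'|].
  rewrite mxE; apply: rpredD; first exact: hv.
  rewrite mxE rpredN mxE mul_mpolyC rpredZ // mxE eqxx.
  by case: eqP => _; rewrite ?dhomog1 ?dhomog0.
by rewrite mulmxBl hlam -scalemxAl mul_delta_var_col scale_scalar_mx subrr.
Qed.

Local Notation cocycle := (koszul_d (fun i : 'I_k.+2 => 'X_i : S)).

(* The defect of t is a cocycle with values in S(-e-1)^k; it is a coboundary
   except when k = 1 and e = 2, where H^1 of the twisted tangent bundle of the
   plane does not vanish. *)
Lemma cocycle_lift W X (t : 'I_k.+2 -> 'I_k.+2 -> 'rV[S]_k.+2) :
    resolves e W X -> (0 < k)%N -> (0 < e)%N -> (k, e) <> (1, 2)%N ->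
    (forall i j l, t i j 0 l \is 1.-homog) -> (forall i j, t i j = - t j i) ->
    (forall i j, t i j *m x = 0) ->
    (forall i j l, contract X (cocycle t i j l) = 0) ->
  exists (u : 'I_k.+2 -> 'I_k.+2 -> 'rV[S]_k.+2) (a : F), a != 0 /\
    [/\ forall i j l, u i j 0 l \is 1.-homog, forall i j, u i j = - u j i,
        forall i j, u i j *m x = 0, forall i j l, cocycle u i j l = 0
      & forall i j, contract X (u i j) = a%:MP * contract X (t i j)].
Proof.
move=> HW k0 e0 ke ht ta tx ft.
have hX1 (i : 'I_k.+2) : ('X_i : S) \is 1.-homog by rewrite dhomogX /= mdeg1.
have hA i j l r : cocycle t i j l 0 r \is 2.-homog.
  rewrite koszul_dE; apply: rpredD; first apply: rpredB; exact: (dhomogM (hX1 _) (ht _ _ _)).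
have Ax i j l : cocycle t i j l *m x = 0.
  exact: koszul_d_mulmx.
have trivial_defect : (forall i j l, cocycle t i j l = 0) ->
    exists (u : 'I_k.+2 -> 'I_k.+2 -> 'rV[S]_k.+2) (a : F), a != 0 /\
    [/\ forall i j l, u i j 0 l \is 1.-homog, forall i j, u i j = - u j i,
        forall i j, u i j *m x = 0, forall i j l, cocycle u i j l = 0
      & forall i j, contract X (u i j) = a%:MP * contract X (t i j)].
  move=> A0; exists t, 1; split; first exact: oner_neq0.
  by split=> // i j; rewrite mpolyC1 mul1r.
(* The defect has degree 2, below the degree of the rows when [e] exceeds 2, so exactness makes it
   zero. *)
have [e2|e2] := ltnP 2 e.
  by apply: trivial_defect => i j l; apply: (contract_exact_lt HW e2).
have /fin_all_exists [c hc] : forall ijl : 'I_k.+2 * 'I_k.+2 * 'I_k.+2,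
    exists c : 'rV[S]_k, (forall r, c 0 r \is (2 - e).-homog) /\
      cocycle t ijl.1.1 ijl.1.2 ijl.2 = c *m W.
  by move=> [[i j] l]; apply: (contract_exact_homog HW) => // r; rewrite subnK.
have hcr i j l r : c (i, j, l) 0 r \is (2 - e).-homog by case: (hc (i, j, l)).
have AE i j l : cocycle t i j l = c (i, j, l) *m W by case: (hc (i, j, l)).
have freeW (c1 c2 : 'rV[S]_k) : c1 *m W = c2 *m W -> c1 = c2.
  move=> c12; apply/eqP; rewrite -subr_eq0; apply/eqP/(rows_free HW).
  by rewrite mulmxBl c12 subrr.
have cN1 i j l : c (i, j, l) = - c (j, i, l).
  by apply: freeW; rewrite mulNmx -!AE koszul_dN12.
have cN2 i j l : c (i, j, l) = - c (i, l, j).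
  by apply: freeW; rewrite mulNmx -!AE koszul_dN23.
have xc i j l m : 'X_i *: c (j, l, m) - 'X_j *: c (i, l, m) + 'X_l *: c (i, j, m)
    - 'X_m *: c (i, j, l) = 0.
  apply: (rows_free HW); rewrite mulmxBl mulmxDl mulmxBl -!scalemxAl -!AE.
  exact: koszul_dd.
have cN1r r i j l : c (i, j, l) 0 r = - c (j, i, l) 0 r by rewrite cN1 mxE.
have cN2r r i j l : c (i, j, l) 0 r = - c (i, l, j) 0 r by rewrite cN2 mxE.
have xcr r i j l m : 'X_i * c (j, l, m) 0 r - 'X_j * c (i, l, m) 0 r
    + 'X_l * c (i, j, m) 0 r - 'X_m * c (i, j, l) 0 r = 0.
  by have /rowP/(_ r) := xc i j l m; rewrite row_combination4E [RHS]mxE.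
have hom3 r := @koszul_homotopy3 F k.+2 (2 - e) (fun i j l => c (i, j, l) 0 r)
  (fun i j l => hcr i j l r) (cN1r r) (cN2r r) (xcr r).
pose w i j : 'rV[S]_k := \row_r \sum_m (c (m, i, j) 0 r)^`M(m).
(* The three-index homotopy leaves the factor (k + 2) + (2 - e) - 3 = k + 1 - e, which for [e <= 2]
   is zero only at the excluded pair. *)
have cE i j l : c (i, j, l) *+ (k.+1 - e) =
    'X_i *: w j l - 'X_j *: w i l + 'X_l *: w i j.
  apply: (@addrI _ (c (i, j, l) *+ 3)); rewrite -mulrnDr.
  have -> : (3 + (k.+1 - e) = k.+2 + (2 - e))%N by lia.
  apply/rowP => r; apply: etrans (mulmxnE _ _ _ _) _; rewrite -scaler_nat hom3.
  by rewrite [RHS]row_combinationE !mxE.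
have ke_gt0 : (0 < k.+1 - e)%N.
  by rewrite subn_gt0; case: (ltngtP e k.+1) => // [|ek]; [lia | case: ke; congr (_, _); lia].
have nz : (k.+1 - e)%:R != 0 :> F by rewrite ((pcharf0P F).1 F0) -lt0n.
(* For e = 2 the [c] are constants, so [w] and then [c] vanish. For e = 1 the [w] are constants, and
   subtracting w W from a multiple of [t] removes the defect. *)
have [e_eq2|e_eq1] : e = 2 \/ e = 1 by lia.
  apply: trivial_defect => i j l; rewrite AE.
  have w0 i' j' : w i' j' = 0.
    apply/rowP => r; rewrite !mxE big1 // => m _; apply: mderiv_const.
    by have := hcr m i' j' r; rewrite e_eq2.
  suff -> : c (i, j, l) = 0 by rewrite mul0mx.
  have := cE i j l; rewrite !w0 !scaler0 subrr !addr0 => /rowP c0.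
  apply/rowP => r; have := c0 r; rewrite mulmxnE !mxE -scaler_nat.
  exact: scaler_nat_eq0.
have hw i j r : w i j 0 r \is 0.-homog.
  rewrite mxE rpred_sum // => m _; have := hcr m i j r; rewrite e_eq1.
  exact: (mderiv_homog m).
have wN i j : w i j = - w j i.
  apply/rowP => r; rewrite !mxE -sumrN; apply: eq_bigr => m _.
  by rewrite cN2 mxE mderivN.
exists (fun i j => t i j *+ (k.+1 - e) - w i j *m W), (k.+1 - e)%:R; split=> //.
split=> [i j l|i j|i j|i j l|i j].
- rewrite row_mulrnBE; apply: rpredB; first by apply: rpredMn.
  rewrite mxE rpred_sum // => r _.
  by have := dhomogM (hw i j r) (rows_homog HW r l); rewrite add0n e_eq1.
- by rewrite ta wN mulNmx mulNrn opprB opprK addrC.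
- by rewrite mulmxBl mulmxMnl tx mul0rn -mulmxA (rows_var_col HW) mulmx0 subrr.
- rewrite koszul_d_mulrnB AE -mulmxMnl cE.
  by rewrite subrr.
rewrite contractB (rows_contract HW) subr0 mpolyC_nat.
by rewrite -scaler_nat contractZ.
Qed.

(** The minors of [W'] lift to forms with linear coefficients; corrected by [cocycle_lift], the
    lifts are multiples of the radial forms by [radial_rigid], so the two families of minors are
    proportional. Then [X] kills the rows of [W'], which lie in the span of [W] with constant
    coefficients by degree. *)
Lemma minors_determine_rows W X W' X' :
    resolves e W X -> resolves e W' X' -> (0 < k)%N -> (0 < e)%N ->
    (k, e) <> (1, 2)%N ->
    (forall g, ideal_gen (bminor W') g -> ideal_gen (bminor W) g) ->
  exists M : 'M[F]_k, W' = map_mx (@mpolyC k.+2 F) M *m W.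
Proof.
move=> HW HW' k0 e0 ke sub_I.
have degE : (1 + (k * e).-1 = k * e)%N by rewrite add1n prednK // muln_gt0 k0.
have /fin_all_exists [s hs] : forall ij : 'I_k.+2 * 'I_k.+2, exists a : 'rV[S]_k.+2,
    [/\ forall i, a 0 i \is 1.-homog, a *m x = 0 & bminor W' ij = contract X a].
  move=> [i j]; have hp : bminor W' (i, j) \is (1 + (k * e).-1).-homog.
    by rewrite degE; apply: (bminor_homog (rows_homog HW')).
  apply/(contract_image_homog HW hp)/sub_I.
  by have [_ _ _] := ideal_genMn (bminor W'); apply.
(* Antisymmetrizing the chosen lifts doubles their contraction. *)
pose t i j := s (i, j) - s (j, i).
have ft i j : contract X (t i j) = bminor W' (i, j) *+ 2.
  rewrite contractB; have [_ _ <-] := hs (i, j); have [_ _ <-] := hs (j, i).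
  by rewrite (bminor_antisym W' j i) opprK.
have ht i j l : t i j 0 l \is 1.-homog.
  rewrite mxE; apply: rpredD; first by case: (hs (i, j)).
  by rewrite mxE rpredN; case: (hs (j, i)).
have ta i j : t i j = - t j i by rewrite opprB.
have tx i j : t i j *m x = 0.
  by rewrite mulmxBl; have [_ -> _] := hs (i, j); have [_ -> _] := hs (j, i); rewrite subrr.
have ct i j l : contract X (cocycle t i j l) = 0.
  have -> : contract X (cocycle t i j l) = 'X_i * contract X (t j l)
      - 'X_j * contract X (t i l) + 'X_l * contract X (t i j).
    exact: (koszul_d_mulmxE (fun i => 'X_i : S) t X i j l 0).
  rewrite !ft !mulrnAr.
  by rewrite -mulrnBl -mulrnDl (bminor_koszul (rows_var_col HW')) mul0rn.
have [u [a [a0 [hu ua ux cu fu]]]] := cocycle_lift HW k0 e0 ke ht ta tx ct.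
have [lam tlam] := radial_rigid hu ua ux cu.
have pE i j : (k.+1%:R * a *+ 2) *: bminor W' (i, j) = lam *: bminor W (i, j).
  have := congr1 (contract X) (tlam i j).
  rewrite !contractZ fu ft -(contract_radial (bminor_field HW)) => /esym.
  rewrite -!mul_mpolyC => ->; rewrite mpolyCMn mpolyCM mulrnAr mulrnAr mulrnAl mulrA //.
have nz : k.+1%:R * a *+ 2 != 0.
  rewrite -mulr_natr !mulf_neq0 ?((pcharf0P F).1 F0) //.
have lam0 : lam != 0.
  have [[i j] p0] := minors_neq0 HW'; apply: contraNneq p0 => lam0.
  by have /eqP := pE i j; rewrite lam0 scale0r scaler_eq0 (negPf nz).
(* A determinant bordered by a row of [W'] vanishes over [W'], hence over [W] by proportionality; so
   [X] kills that row. *)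
have rows_span r : exists c : 'rV[S]_k,
    (forall r', c 0 r' \is 0.-homog) /\ row r W' = c *m W.
  have rx : row r W' *m x = 0 by rewrite -row_mul (rows_var_col HW') row0.
  apply: (contract_exact_homog HW) => [i||] //.
    by rewrite mxE; apply: rows_homog HW' _ _.
  pose j0 := top0 k; have := border_contract (bminor_field HW) j0 rx.
  rewrite (_ : \det _ = 0) => [/esym/eqP|].
    by rewrite mulf_eq0 (negPf (mpolyX_neq0 _ _)) => /eqP.
  apply: (can_inj (scalerK lam0)); rewrite scaler0 det_border_expand.
  transitivity ((k.+1%:R * a *+ 2) *: \det (border (delta_mx 0 j0) (row r W') W')).
    rewrite det_border_expand !scaler_sumr; apply: eq_bigr => l _.
    exact: scaler_mul_swap (pE _ _).
  by rewrite det_border_row scaler0.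
have [c hc] := fin_all_exists rows_span.
exists (\matrix_(r, r') (c r 0 r')@_0%MM); apply/row_matrixP => r.
rewrite row_mul; have [h0 ->] := hc r; congr (_ *m _); apply/rowP => r'.
by rewrite !mxE -dhomog0_const.
Qed.

End Recovery.

(** * The open condition *)

Section CongruenceOnLine.
Variables (F : fieldType) (n : nat) (i0 i1 : 'I_n).
Implicit Types p q : {mpoly F[n]}.

Definition eq_on_line p q := vanishes_to i0 i1 1 (p - q).

Lemma eq_on_line_refl p : eq_on_line p p.
Proof. by move=> m _; rewrite subrr mcoeff0. Qed.

Lemma eq_on_lineD p p' q q' :
  eq_on_line p p' -> eq_on_line q q' -> eq_on_line (p + q) (p' + q').
Proof.
by move=> hp hq m hm; rewrite opprD addrACA mcoeffD hp // hq // addr0.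
Qed.

Lemma eq_on_lineM p p' q q' :
  eq_on_line p p' -> eq_on_line q q' -> eq_on_line (p * q) (p' * q').
Proof.
move=> hp hq; have v0 (r : {mpoly F[n]}) : vanishes_to i0 i1 0 r by move=> m; rewrite ltn0.
rewrite /eq_on_line; have -> : p * q - p' * q' = (p - p') * q + p' * (q - q') by ring.
move=> m hm; rewrite mcoeffD (vanishes_toM hp (v0 q)) ?addn0 //.
by rewrite (vanishes_toM (v0 p') hq) ?add0n // addr0.
Qed.

Lemma eq_on_lineX0 j : j != i0 -> j != i1 -> eq_on_line 'X_j 0.
Proof.
move=> j0 j1 m; rewrite subr0 ltnS leqn0 mcoeffX => /eqP hm; case: eqP => // jm.
by move: hm; rewrite -jm /off_line (bigD1 j) ?j0 //= mnm1E eqxx.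
Qed.

Lemma eq_on_line_det m (A B : 'M[{mpoly F[n]}]_m) :
  (forall i j, eq_on_line (A i j) (B i j)) -> eq_on_line (\det A) (\det B).
Proof.
move=> hAB; apply: (big_ind2 eq_on_line); [exact: eq_on_line_refl | exact: eq_on_lineD |].
move=> s _; apply: eq_on_lineM; first exact: eq_on_line_refl.
apply: (big_ind2 eq_on_line); [exact: eq_on_line_refl | exact: eq_on_lineM |] => //.
Qed.

Lemma eq_on_line_coef p q m : eq_on_line p q -> off_line i0 i1 m = 0%N -> p@_m = q@_m.
Proof. by move=> pq hm; apply/eqP; rewrite -subr_eq0 -mcoeffB pq ?hm. Qed.

End CongruenceOnLine.

(** The Cauchy-Binet formula before the maps [h] are grouped by image, which matches the redundant
    indexing of [plucker]. *)
Lemma det_expand_columns (R : comNzRingType) k m (A : 'M[R]_(k, m)) (B : 'M[R]_(m, k)) :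
  \det (A *m B) = \sum_(h : {ffun 'I_k -> 'I_m})
    (\prod_j B (h j) j) * \det (\matrix_(i, j) A i (h j)).
Proof.
rewrite -det_tr [LHS]/determinant.
under eq_bigr => s _.
  under eq_bigr => j _ do rewrite !mxE.
  rewrite bigA_distr_bigA mulr_sumr /=.
  over.
rewrite exchange_big /=; apply: eq_bigr => h _.
rewrite -det_tr /determinant mulr_sumr; apply: eq_bigr => s _.
rewrite big_split /= [RHS]mulrCA; congr (_ * _); rewrite mulrC; congr (_ * _).
by apply: eq_bigr => j _; rewrite !mxE.
Qed.

(** * Sylvester matrices of two forms on the line *)

Section Sylvester.
Variables (F : fieldType) (k e : nat).
Local Notation S := {mpoly F[k.+2]}.
Local Notation D := (k * e)%N.
Local Notation i0 := (top0 k).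
Local Notation i1 := (top1 k).

Definition line_mnm (a b : nat) : 'X_{1..k.+2} := (U_(i0) *+ a + U_(i1) *+ b)%MM.

(* Multiplication by A and B from pairs of binary forms of degree D - 1 to binary
   forms of degree 2 D - 1, after restriction to the line spanned by the
   coordinate points i0 and i1. *)
Definition sylvester (A B : S) : 'M[F]_(D + D) :=
  \matrix_(r, j) match split r with
    | inl i => ('X_[line_mnm i (D - i.+1)] * A)@_(line_mnm j (D + D - j.+1))
    | inr i => ('X_[line_mnm i (D - i.+1)] * B)@_(line_mnm j (D + D - j.+1))
    end.

Lemma i01_neq : i0 != i1. Proof. by rewrite -val_eqE. Qed.

Lemma line_mnm0 a b : line_mnm a b i0 = a.
Proof. by rewrite mnmDE !mulmnE !mnm1E eqxx eq_sym (negPf i01_neq) mul1n mul0n addn0. Qed.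

Lemma line_mnm1 a b : line_mnm a b i1 = b.
Proof. by rewrite mnmDE !mulmnE !mnm1E eqxx (negPf i01_neq) mul1n mul0n. Qed.

Lemma mdeg_line_mnm a b : mdeg (line_mnm a b) = (a + b)%N.
Proof. by rewrite mdegD !mdegMn !mdeg1 !mul1n. Qed.

Lemma off_line_mnm a b : off_line i0 i1 (line_mnm a b) = 0%N.
Proof. by rewrite off_lineD !off_line_pow ?eqxx ?orbT. Qed.

Lemma off_line0P m : off_line i0 i1 m = 0%N -> m = line_mnm (m i0) (m i1).
Proof.
move=> /eqP; rewrite sum_nat_eq0 => /forallP m0; apply/mnmP => i.
have [->|ne0] := eqVneq i i0; first by rewrite line_mnm0.
have [->|ne1] := eqVneq i i1; first by rewrite line_mnm1.
have /eqP -> := implyP (m0 i) (introT andP (conj ne0 ne1)).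
by rewrite mnmDE !mulmnE !mnm1E ![_ == i]eq_sym (negPf ne0) (negPf ne1).
Qed.

(** Row [j] of the inverse matrix holds the coefficients of the multipliers [u] and [v] that produce
    a single monomial on the line. *)
Lemma sylvester_powers (A B : S) (j : 'I_(D + D)) :
    A \is D.-homog -> B \is D.-homog -> \det (sylvester A B) != 0 ->
  exists u v : S, let G := u * A + v * B in G \is (D + D).-1.-homog /\
    forall m, off_line i0 i1 m = 0%N ->
      G@_m = (m == line_mnm j (D + D - j.+1))%:R.
Proof.
move=> hA hB; rewrite -unitfE => unitT.
pose c : 'rV_(D + D) := delta_mx 0 j *m invmx (sylvester A B).
have cT : c *m sylvester A B = delta_mx 0 j by rewrite -mulmxA mulVmx ?mulmx1.
pose u := \sum_(i < D) c 0 (lshift D i) *: 'X_[line_mnm i (D - i.+1)] : S.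
pose v := \sum_(i < D) c 0 (rshift D i) *: 'X_[line_mnm i (D - i.+1)] : S.
have hX (i : 'I_D) : ('X_[line_mnm i (D - i.+1)] : S) \is D.-1.-homog.
  by rewrite dhomogX /= mdeg_line_mnm; apply/eqP; have := ltn_ord i; lia.
have Dpos : (0 < D)%N by have := ltn_ord j; lia.
have degE : ((D + D).-1 = D.-1 + D)%N by lia.
have hG : u * A + v * B \is (D + D).-1.-homog.
  by rewrite degE; apply: rpredD; apply: dhomogM => //; apply: rpred_sum => i _; apply: rpredZ.
exists u, v; split=> // m hm.
have [mN|/negPf mN] := eqVneq (mdeg m) (D + D).-1; last first.
  rewrite (dhomog_nemf_coeff hG) ?mN //; case: eqP => // mE.
  by move: mN; rewrite mE mdeg_line_mnm; have := ltn_ord j; lia.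
have mdE : mdeg m = (m i0 + m i1)%N by rewrite {1}(off_line0P hm) mdeg_line_mnm.
have mE : m = line_mnm (m i0) (D + D - (m i0).+1).
  by rewrite {1}(off_line0P hm); congr (line_mnm _ _); lia.
have lt_m : (m i0 < D + D)%N by lia.
have /rowP/(_ (Ordinal lt_m)) := cT; rewrite mxE big_split_ord /= [RHS]mxE eqxx /= => GE.
have -> : (m == line_mnm j (D + D - j.+1)) = (Ordinal lt_m == j).
  apply/eqP/eqP => [mj|<- //]; apply: val_inj; rewrite /= mj line_mnm0 //.
rewrite -GE mcoeffD; congr (_ + _); rewrite mulr_suml raddf_sum /=; apply: eq_bigr => i _.
  rewrite -scalerAl mcoeffZ [sylvester _ _ _ _]mxE (unsplitK (inl i) : split (lshift D i) = _).
  by congr (_ * _); rewrite {1}mE.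
rewrite -scalerAl mcoeffZ [sylvester _ _ _ _]mxE (unsplitK (inr i) : split (rshift D i) = _).
by congr (_ * _); rewrite {1}mE.
Qed.

End Sylvester.

(** * Wedge products in Plücker coordinates *)

Section Wedge.
Variables (F : fieldType) (k e : nat).
Local Notation S := {mpoly F[k.+2]}.
Local Notation form := (cone_form F k.+1 e).

Lemma form_coord_sum m (v : m.-tuple form) (c : 'I_m -> F) j :
  (((\sum_b c b *: v`_b) : form) j : S) = \sum_b (c b)%:MP * ((v`_b : form) j : S).
Proof.
rewrite sum_ffunE raddf_sum /=; apply: eq_bigr => b _.
by rewrite ffunE linearZ /= mul_mpolyC.
Qed.

Definition column_monomial (V : {vspace form}) (J : {ffun 'I_k -> 'I_k.+2})
    (a : 'I_#|{ffun 'I_k -> 'I_(\dim V)}|) : S :=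
  \prod_j (((vbasis V)`_(enum_val a j) : form) (J j) : S).

Lemma wedge_coef_plucker (V : {vspace form}) (w : k.-tuple form) J :
    (forall i, tnth w i \in V) ->
  wedge_coef w J = \sum_a @plucker F _ k V w a *: column_monomial J a.
Proof.
move=> wV; rewrite /wedge_coef.
pose A : 'M[S]_(k, \dim V) := \matrix_(i, b) (coord (vbasis V) b (tnth w i))%:MP.
pose B : 'M[S]_(\dim V, k) := \matrix_(b, j) (((vbasis V)`_b : form) (J j) : S).
rewrite (_ : \matrix_(i, j) _ = A *m B).
  rewrite det_expand_columns (reindex_onto (@enum_val _ _) enum_rank) /=.
    2: by move=> h _; rewrite enum_rankK.
  apply: eq_big => [a|a _]; first by rewrite enum_valK eqxx.
  rewrite -mul_mpolyC mulrC; congr (_ * _).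
    rewrite -det_map_mx; congr (\det _); by apply/matrixP => i j; rewrite !mxE.
  by apply: eq_bigr => j _; rewrite mxE.
apply/matrixP => i j; rewrite !mxE {1}(coord_vbasis (wV i)) form_coord_sum.
by apply: eq_bigr => b _; rewrite !mxE.
Qed.

Lemma wedge_coef_basis (W : {vspace form}) (w w' : k.-tuple form) :
    basis_of W w -> basis_of W w' ->
  exists c : F, forall J, wedge_coef w' J = c *: wedge_coef w J.
Proof.
move=> bw bw'; exists (\det (\matrix_(i, b) coord w b (tnth w' i))) => J.
rewrite -mul_mpolyC -det_map_mx -det_mulmx; congr (\det _).
apply/matrixP => i j; rewrite !mxE.
have w'W : tnth w' i \in W by rewrite (basis_mem bw') // mem_tnth.
rewrite {1}(coord_basis bw w'W) form_coord_sum.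
by apply: eq_bigr => b _; rewrite !mxE (tnth_nth 0 w b).
Qed.

(** Both minors avoid column [top1 k]; this one also avoids the last column, and [last_minor] avoids
    column [top0 k]. *)
Definition first_minor : {ffun 'I_k -> 'I_k.+2} :=
  [ffun r => lift (top1 k) (widen_ord (leqnSn k) r)].
Definition last_minor : {ffun 'I_k -> 'I_k.+2} := [ffun r => lift (top1 k) (lift ord0 r)].

Definition form_sylvester (w : k.-tuple form) :=
  sylvester e (wedge_coef w first_minor) (wedge_coef w last_minor).

Lemma sylvesterD (I : finType) (f : I -> F) (A B : I -> S) :
  sylvester e (\sum_a f a *: A a) (\sum_a f a *: B a) =
    \sum_a f a *: sylvester e (A a) (B a).
Proof.
apply/matrixP => i j; rewrite mxE summxE.
under [RHS]eq_bigr => a _ do rewrite mxE mxE.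
case: split => l; rewrite mulr_sumr raddf_sum; apply: eq_bigr => a _ /=;
  by rewrite -scalerAr mcoeffZ.
Qed.

Lemma sylvesterZ c (A B : S) : sylvester e (c *: A) (c *: B) = c *: sylvester e A B.
Proof.
by apply/matrixP => i j; rewrite !mxE; case: split => l; rewrite -scalerAr mcoeffZ.
Qed.

Lemma form_sylvester_basis (W : {vspace form}) (w w' : k.-tuple form) :
    basis_of W w -> basis_of W w' ->
  \det (form_sylvester w') != 0 -> \det (form_sylvester w) != 0.
Proof.
move=> bw bw'; have [c cE] := wedge_coef_basis bw bw'.
have -> : form_sylvester w' = c *: form_sylvester w.
  by rewrite /form_sylvester !cE sylvesterZ.
by rewrite detZ mulf_eq0 negb_or => /andP [].
Qed.

Section Discriminant.
Variable V : {vspace form}.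

(** Wedge coefficients are linear in the Plücker coordinates; with variables in place of these, the
    Sylvester determinant becomes a polynomial on Plücker space. *)
Definition discriminant : {mpoly F[#|{ffun 'I_k -> 'I_(\dim V)}|]} :=
  \det (\sum_a 'X_a *: map_mx (@mpolyC _ F)
    (sylvester e (column_monomial first_minor a) (column_monomial last_minor a))).

Lemma discriminant_homog : exists d, discriminant \is d.-homog.
Proof.
exists ((k * e + k * e) * 1)%N; apply: det_homog => i j; rewrite summxE.
apply: rpred_sum => a _; rewrite !mxE mulrC mul_mpolyC rpredZ //.
by rewrite dhomogX /= mdeg1.
Qed.

Lemma discriminant_eval (w : k.-tuple form) : (forall i, tnth w i \in V) ->
  discriminant.@[@plucker F _ k V w] = \det (form_sylvester w).
Proof.
move=> wV; rewrite /discriminant -det_map_mx; congr (\det _).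
rewrite /form_sylvester !(wedge_coef_plucker _ wV) sylvesterD.
apply/matrixP => i j; rewrite mxE !summxE raddf_sum; apply: eq_bigr => a _ /=.
by rewrite 2!mxE mevalM mevalXU mevalC [in RHS]mxE.
Qed.

End Discriminant.
End Wedge.

Lemma row_scaleD2E (R : comNzRingType) n (a b : R) (A B : 'rV[R]_n) r :
  (a *: A + b *: B) 0 r = a * A 0 r + b * B 0 r.
Proof. by rewrite !mxE. Qed.

Lemma row_delta2E (R : comNzRingType) n (a b : R) (i j l : 'I_n) :
  (a *: delta_mx 0 j - b *: delta_mx 0 i : 'rV[R]_n) 0 l =
    a * (l == j)%:R - b * (l == i)%:R.
Proof. by rewrite !mxE. Qed.

Lemma mulmx_scaleD2_eq0 (R : comNzRingType) m n (a b : R) (A B : 'rV[R]_m) (M : 'M_(m, n)) :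
  A *m M = 0 -> B *m M = 0 -> (a *: A + b *: B) *m M = 0.
Proof. by move=> AM BM; rewrite mulmxDl -!scalemxAl AM BM !scaler0 addr0. Qed.

(** * The open condition suffices and is satisfied by an example *)

Section GeneralForms.
Variables (F : fieldType) (k e : nat).
Hypothesis F0 : [pchar F] =i pred0.
Hypotheses (k_gt0 : (0 < k)%N) (e_gt0 : (0 < e)%N).
Local Notation S := {mpoly F[k.+2]}.
Local Notation form := (cone_form F k.+1 e).
Local Notation D := (k * e)%N.
Local Notation i0 := (top0 k).
Local Notation i1 := (top1 k).

Lemma form_mx_homog (w : k.-tuple form) r i : form_mx w r i \is e.-homog.
Proof. by rewrite mxE dhomog_is_dhomog. Qed.

Lemma form_mx_var_col (w : k.-tuple form) :
    (forall i, form_row (tnth w i) *m var_col F k = 0) ->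
  form_mx w *m var_col F k = 0.
Proof.
move=> wx; apply/row_matrixP => r; rewrite row_mul row0 -(wx r).
by congr (_ *m _); apply/rowP => i; rewrite !mxE.
Qed.

Lemma sylvester_resolves (w : k.-tuple form) :
    (forall i, form_row (tnth w i) *m var_col F k = 0) ->
  \det (form_sylvester w) != 0 -> exists X, resolves e (form_mx w) X.
Proof.
move=> wx dw; have D_gt0 : (0 < D)%N by rewrite muln_gt0 k_gt0.
have hA J : wedge_coef w J \is D.-homog by apply: wedge_coef_homog.
have wI u v : ideal_gen (bminor (form_mx w))
    (u * wedge_coef w (first_minor k) + v * wedge_coef w (last_minor k)).
  rewrite -ideal_gen_wedge; have [_ gD gM gg] := ideal_genMn (@wedge_coef F k.+1 e k w).
  by apply: gD; apply: gM; apply: gg.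
have ltN : ((D + D).-1 < D + D)%N by lia.
have lt0 : (0 < D + D)%N by lia.
(* The extreme indices 2D - 1 and 0 give the pure powers of x_i0 and x_i1 of degree 2D - 1. *)
have [u0 [v0 [h0 h0']]] := sylvester_powers (Ordinal ltN) (hA _) (hA _) dw.
have [u1 [v1 [h1 h1']]] := sylvester_powers (Ordinal lt0) (hA _) (hA _) dw.
apply: (codim2_resolves F0 k_gt0 (form_mx_homog w) (form_mx_var_col wx) (i01_neq k)
  _ _ (wI u0 v0) (wI u1 v1)); split; [exact: h0 | | exact: h1 | ].
  move=> m /h0' ->; congr (_ == _)%:R; rewrite /line_mnm /= prednK // subnn mulm0n addm0 //.
move=> m /h1' ->; congr (_ == _)%:R; rewrite /line_mnm /= subn1 mulm0n add0m //.
Qed.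

Section Example.

(** Away from column [i1], these rows restrict on the line to a bidiagonal matrix with entries
    x_i1^e and x_i0^e, so the two chosen minors become triangular. *)
Definition example_row (r : 'I_k) : 'rV[S]_k.+2 :=
  'X_i1 ^+ e.-1 *: radial F i1 (first_minor k r) +
  'X_i0 ^+ e.-1 *: radial F i0 (last_minor k r).

Lemma radialE (i j l : 'I_k.+2) :
  radial F i j 0 l = 'X_i * (l == j)%:R - 'X_j * (l == i)%:R.
Proof. exact: row_delta2E. Qed.

Lemma example_rowE r j : example_row r 0 j =
  'X_i1 ^+ e.-1 * ('X_i1 * (j == first_minor k r)%:R - 'X_(first_minor k r) * (j == i1)%:R)
  + 'X_i0 ^+ e.-1 * ('X_i0 * (j == last_minor k r)%:R - 'X_(last_minor k r) * (j == i0)%:R).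
Proof. rewrite -!radialE; exact: row_scaleD2E. Qed.

Lemma example_row_homog r j : example_row r 0 j \is e.-homog.
Proof.
have hX (i : 'I_k.+2) : ('X_i : S) \is 1.-homog by rewrite dhomogX /= mdeg1.
have hXn (i : 'I_k.+2) : ('X_i : S) ^+ e.-1 \is e.-1.-homog.
  by have := dhomogMn e.-1 (hX i); rewrite mul1n.
have hb (i : 'I_k.+2) (b : bool) : ('X_i : S) * b%:R \is 1.-homog.
  by case: b; rewrite ?mulr1 ?mulr0 ?dhomog0.
suff : example_row r 0 j \is (e.-1 + 1).-homog by rewrite addn1 prednK.
rewrite example_rowE.
by apply: rpredD; apply: dhomogM => //; apply: rpredB.
Qed.

Definition example : k.-tuple form :=
  [tuple [ffun i => DHomog (example_row_homog r i)] | r < k].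

Lemma example_form_row r : form_row (tnth example r) = example_row r.
Proof. by apply/rowP => i; rewrite [LHS]mxE tnth_mktuple ffunE. Qed.

Lemma example_var_col r : form_row (tnth example r) *m var_col F k = 0.
Proof.
by rewrite example_form_row; apply: mulmx_scaleD2_eq0; apply: radial_var_col.
Qed.

Let first_neq r : (first_minor k r == i1) = false.
Proof. by rewrite ffunE eq_sym (negPf (neq_lift _ _)). Qed.
Let last_neq1 r : (last_minor k r == i1) = false.
Proof. by rewrite ffunE eq_sym (negPf (neq_lift _ _)). Qed.
Let last_neq0 r : (last_minor k r == i0) = false.
Proof. by rewrite ffunE -val_eqE. Qed.

Local Notation eqL := (@eq_on_line F k.+2 i0 i1).

(** In the first row [first_minor k r] is [i0], whose variable survives on the line; that term only
    enters column [i1], which is left out. *)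
Lemma example_row_line r j : j != i1 -> eqL (example_row r 0 j)
  ((j == first_minor k r)%:R * 'X_i1 ^+ e + (j == last_minor k r)%:R * 'X_i0 ^+ e).
Proof.
move=> /negPf j1; rewrite example_rowE j1 mulr0 subr0.
apply: eq_on_lineD.
  by rewrite mulrA -exprSr prednK // mulrC; apply: eq_on_line_refl.
have -> : (j == last_minor k r)%:R * 'X_i0 ^+ e =
    'X_i0 ^+ e.-1 * ('X_i0 * (j == last_minor k r)%:R - 0 * (j == i0)%:R) :> S.
  by rewrite mul0r subr0 mulrA -exprSr prednK // mulrC.
apply: eq_on_lineM; first exact: eq_on_line_refl.
apply: eq_on_lineD; first exact: eq_on_line_refl.
rewrite -!mulNr; apply: eq_on_lineM; last exact: eq_on_line_refl.
have := @eq_on_lineX0 F k.+2 i0 i1 (last_minor k r).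
rewrite last_neq0 last_neq1 => /(_ isT isT) h m hm.
by have := h m hm; rewrite !oppr0 !addr0 mcoeffN => ->; rewrite oppr0.
Qed.

Lemma example_first : eqL (wedge_coef example (first_minor k)) ('X_i1 ^+ D).
Proof.
pose A : 'M[S]_k := \matrix_(r, j) ((j == r)%:R * 'X_i1 ^+ e
  + (nat_of_ord j == r.+1)%:R * 'X_i0 ^+ e).
have -> : 'X_i1 ^+ D = \det A.
  rewrite -det_tr det_trig.
    rewrite mulnC exprM -[X in _ ^+ X]card_ord -prodr_const; apply: eq_bigr => r _.
    by rewrite !mxE eqxx -[(_ == _.+1)]negbK neq_ltn ltnSn mul1r mul0r addr0.
  apply/is_trig_mxP => r j rj; rewrite !mxE -val_eqE /= ltn_eqF // mul0r add0r.
  by rewrite ltn_eqF ?mul0r // ltnS ltnW.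
apply: eq_on_line_det => r j; rewrite [X in eqL X]mxE [X in eqL _ X]mxE.
have := @example_row_line r (first_minor k j); rewrite first_neq => /(_ isT).
rewrite -(example_form_row r) [X in eqL X]mxE.
congr (eqL _ (_%:R * _ + _%:R * _)).
  by rewrite !ffunE (inj_eq lift_inj).
rewrite !ffunE (inj_eq lift_inj) -val_eqE //.
Qed.

Lemma example_last : eqL (wedge_coef example (last_minor k)) ('X_i0 ^+ D).
Proof.
pose A : 'M[S]_k := \matrix_(r, j) ((nat_of_ord r == j.+1)%:R * 'X_i1 ^+ e
  + (j == r)%:R * 'X_i0 ^+ e).
have -> : 'X_i0 ^+ D = \det A.
  rewrite det_trig.
    rewrite mulnC exprM -[X in _ ^+ X]card_ord -prodr_const; apply: eq_bigr => r _.
    by rewrite !mxE eqxx -[(_ == _.+1)]negbK neq_ltn ltnSn mul1r mul0r add0r.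
  apply/is_trig_mxP => r j rj; rewrite !mxE -val_eqE /=.
  by rewrite (ltn_eqF (leqW rj)) (gtn_eqF rj) !mul0r addr0.
apply: eq_on_line_det => r j; rewrite [X in eqL X]mxE [X in eqL _ X]mxE.
have := @example_row_line r (last_minor k j); rewrite last_neq1 => /(_ isT).
rewrite -(example_form_row r) [X in eqL X]mxE.
congr (eqL _ (_%:R * _ + _%:R * _)).
  by rewrite !ffunE (inj_eq lift_inj) -val_eqE /= eq_sym.
by rewrite !ffunE (inj_eq lift_inj) (inj_eq lift_inj).
Qed.

(** On the line the two minors are x_i1^D and x_i0^D; their products with the monomials of degree D
    - 1 run once through the monomials of degree 2D - 1, in the order of the columns. *)
Lemma example_sylvester : form_sylvester example = 1%:M.
Proof.
have lineE a b (A B : S) m : eqL A B -> off_line i0 i1 m = 0%N ->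
    ('X_[line_mnm k a b] * A)@_m = ('X_[line_mnm k a b] * B)@_m.
  move=> AB hm; apply: eq_on_line_coef hm.
  by apply: eq_on_lineM => //; apply: eq_on_line_refl.
have mnmE a b a' b' : (line_mnm k a b == line_mnm k a' b') = (a == a') && (b == b').
  apply/eqP/andP => [ab|[/eqP -> /eqP -> //]].
  split; apply/eqP; first by rewrite -(line_mnm0 k a b) ab line_mnm0.
  by rewrite -(line_mnm1 k a b) ab line_mnm1.
apply/matrixP => r j; rewrite /form_sylvester [LHS]mxE [RHS]mxE -val_eqE /=.
case: splitP => i rE.
  rewrite (lineE _ _ _ _ _ example_first (off_line_mnm _ _ _)) mpolyXn -mpolyXD mcoeffX.
  rewrite [(_ + _)%MM](_ : _ = line_mnm k i (D - i.+1 + D)); last first.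
    by apply/mnmP => l; rewrite !mnmDE !mulmnE mulnDr addnA.
  by rewrite mnmE rE; congr (nat_of_bool _)%:R; have := ltn_ord j; have := ltn_ord i; lia.
rewrite (lineE _ _ _ _ _ example_last (off_line_mnm _ _ _)) mpolyXn -mpolyXD mcoeffX.
rewrite [(_ + _)%MM](_ : _ = line_mnm k (i + D) (D - i.+1)); last first.
  by apply/mnmP => l; rewrite !mnmDE !mulmnE mulnDr addnAC.
by rewrite mnmE rE; congr (nat_of_bool _)%:R; have := ltn_ord j; have := ltn_ord i; lia.
Qed.

End Example.
End GeneralForms.

(** * Generic subspaces *)
Local Open Scope classical_set_scope.

Lemma Sing_basis (F : fieldType) n e m (W : {vspace cone_form F n e}) : \dim W = m ->
  exists w : m.-tuple (cone_form F n e), basis_of W w /\ Sing W = zero_scheme w.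
Proof. by move=> <-; exists (vbasis W); split=> //; apply: vbasisP. Qed.

Section GenericForms.
Variables (F : fieldType) (k e : nat).
Hypothesis F0 : [pchar F] =i pred0.
Hypotheses (k_gt0 : (0 < k)%N) (e_gt0 : (0 < e)%N).
Local Notation S := {mpoly F[k.+2]}.
Local Notation form := (cone_form F k.+1 e).
Variable V : {vspace form}.
Hypothesis mem_V : forall a : form, (a \in V) = (form_row a *m var_col F k == 0).

(** The choice of basis is immaterial by [form_sylvester_basis]. *)
Definition generic_forms : set {vspace form} :=
  [set W | grassmannian k V W /\
           exists w : k.-tuple form, basis_of W w /\ \det (form_sylvester w) != 0].

Lemma basis_subset (W : {vspace form}) (w : k.-tuple form) i :
  (W <= V)%VS -> basis_of W w -> tnth w i \in V.
Proof. by move=> /subvP WV bw; apply/WV; rewrite (basis_mem bw) // mem_tnth. Qed.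

Lemma generic_forms_open : zariski_open k V generic_forms.
Proof.
split=> [W [] //|]; exists [set discriminant V]; split=> [_ ->|W w gW bw].
  exact: discriminant_homog.
have wV i : tnth w i \in V by apply: basis_subset bw; case: gW.
split=> [[_ [w' [bw' dw']]]|[_ ->]].
  exists (discriminant V); first exact: erefl.
  rewrite (discriminant_eval wV); exact: form_sylvester_basis bw bw' dw'.
rewrite (discriminant_eval wV) => dw; split; first exact: gW.
by exists w; split.
Qed.

Lemma generic_forms_nonempty : generic_forms !=set0.
Proof.
pose w := example F k e_gt0; exists <<w>>%VS.
have dw : \det (form_sylvester w) != 0 by rewrite example_sylvester ?det1 ?oner_neq0.
have [X HW] := sylvester_resolves F0 k_gt0 e_gt0 (@example_var_col F k e e_gt0) dw.
(* Independence over the field follows from that of the rows over the polynomial ring, applied to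
   constants. *)
have free_w : free w.
  apply/freeP => c cw i; pose cS : 'rV[S]_k := \row_r (c r)%:MP.
  have cS0 : cS *m form_mx w = 0.
    apply/rowP => j; rewrite mxE [RHS]mxE.
    transitivity (((\sum_b c b *: w`_b : form) j : S)); last by rewrite cw ffunE.
    rewrite form_coord_sum; apply: eq_bigr => b _.
    by rewrite !mxE (tnth_nth 0).
  have /rowP/(_ i) := rows_free HW cS0; rewrite mxE [RHS]mxE => /eqP.
  by rewrite mpolyC_eq0 => /eqP.
split; last by exists w; rewrite /basis_of eqxx.
split; last by rewrite (eqP free_w) size_tuple.
by apply/span_subvP => a /tnthP [i ->]; rewrite mem_V example_var_col.
Qed.

Lemma generic_forms_resolves W : generic_forms W ->
  exists (w : k.-tuple form) X, [/\ basis_of W w, resolves e (form_mx w) X &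
    Sing W = ideal_gen (bminor (form_mx w))].
Proof.
move=> [gW [w' [bw' dw']]]; have [WV dimW] := gW.
have [w [bw SW]] := Sing_basis dimW.
have wx i : form_row (tnth w i) *m var_col F k = 0.
  by apply/eqP; rewrite -mem_V; apply: basis_subset bw.
have [X HW] := sylvester_resolves F0 k_gt0 e_gt0 wx (form_sylvester_basis bw bw' dw').
exists w, X; split=> //; rewrite SW /zero_scheme ideal_gen_wedge.
apply/seteqP; split; first exact: minors_saturated HW.
move=> f If; exists 0%N => m _.
by have [_ _ gM _] := ideal_genMn (bminor (form_mx w)); apply: gM.
Qed.

Lemma generic_forms_hilb : exists P, forall W, generic_forms W -> Hilb P (Sing W).
Proof.
have [P hP] := @exists_hilbert_poly F k e F0.
exists P => W /generic_forms_resolves [w [X [_ HW ->]]]; split.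
  exact: closed_subscheme_minors HW.
exact: hP HW.
Qed.

Lemma generic_forms_sub W W' : (k, e) <> (1, 2)%N -> generic_forms W -> generic_forms W' ->
  Sing W = Sing W' -> (W' <= W)%VS.
Proof.
move=> ke /generic_forms_resolves [w [X [bw HW ->]]].
move=> /generic_forms_resolves [w' [X' [bw' HW' ->]]] eqI.
have [M wM] : exists M : 'M[F]_k, form_mx w' = map_mx (@mpolyC k.+2 F) M *m form_mx w.
  apply: (minors_determine_rows F0 HW HW' k_gt0 e_gt0 ke) => g; rewrite eqI; exact: id.
rewrite -(span_basis bw'); apply/span_subvP => _ /tnthP [i ->].
have -> : tnth w' i = \sum_b M i b *: w`_b.
  apply/ffunP => j; apply: val_inj; rewrite [RHS]form_coord_sum.
  have /matrixP/(_ i j) := wM; rewrite mxE => /= ->; rewrite mxE.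
  by apply: eq_bigr => b _; rewrite !mxE (tnth_nth 0).
by apply: memv_suml => b _; apply: memvZ; apply: (basis_mem bw); rewrite mem_nth ?size_tuple.
Qed.

End GenericForms.

(** The empty wedge product is 1, a determinant of size 0, so the zero scheme is empty. *)
Lemma Sing_dim0 (F : fieldType) n e (W : {vspace cone_form F n e}) : \dim W = 0%N ->
  Sing W = [set: {mpoly F[n.+1]}]%classic.
Proof.
move=> /Sing_basis [w [_ ->]]; apply/seteqP; split=> // f _; exists 0%N => m _.
have [_ _ gM gg] := ideal_genMn (wedge_coef w).
by rewrite -[X in _ X]mulr1; apply: gM; have := gg [ffun=> ord0]; rewrite /wedge_coef det_mx00.
Qed.

Lemma Hilb_empty (F : fieldType) n : @Hilb F n 0 [set: {mpoly F[n.+1]}]%classic.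
Proof.
split; first by split.
exists 0%N => d _; exists fullv; split; last by rewrite horner0 subrr.
by move=> f; rewrite memvf.
Qed.

(** For the excluded pair, T(-3) on the plane is Omega^1, whose H^1 is nonzero, so the lifting
    argument breaks down. A common Hilbert polynomial on [U] places it in the domain of the rational
    map. *)
Theorem corollary4 (R : realType) (n l : nat)
    (hn : (1 <= n)%N) (hl : (2 <= l)%N) (hnl : (n, l) <> (2, 3)%N) :
  exists U : set {vspace cone_form R[i] n l.-1},
    [/\ zariski_open n.-1 (H0Omega1 R[i] n l) U,
        U !=set0,
        exists P : {poly rat}, forall W, U W -> Hilb P (Sing W)
      & forall W W', U W -> U W' -> Sing W = Sing W' -> W = W'].
Proof.
have F0 : [pchar R[i]] =i pred0 by apply: pchar_num.
case: l hl hnl => [//|e] he hnl; have e_gt0 : (0 < e)%N by [].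
case: n hn hnl => [//|[|k]] _ hnl.
  (* On the projective line the Grassmannian is the single point 0, and all of it is taken. *)
  exists (grassmannian 0 (H0Omega1 R[i] 1 e.+1)); split.
  - split=> //; exists [set 1]; split=> [_ ->|W w gW _].
      by exists 0%N; apply: dhomog1.
    by split=> // _; exists 1 => //; rewrite meval1 oner_neq0.
  - by exists 0%VS; split; rewrite ?sub0v ?dimv0.
  - by exists 0 => W [_ dimW]; rewrite (Sing_dim0 dimW); apply: Hilb_empty.
  move=> W W' [_ /eqP dW] [_ /eqP dW'] _; apply/eqP.
  by move: dW dW'; rewrite !dimv_eq0 => /eqP -> /eqP ->.
have memV (a : cone_form R[i] k.+2 e) := @mem_H0Omega1_row R[i] k.+1 e a.
exists (generic_forms (H0Omega1 R[i] k.+2 e.+1 : {vspace cone_form R[i] k.+2 e})).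
split.
- exact: generic_forms_open.
- exact: generic_forms_nonempty memV.
- exact: generic_forms_hilb memV.
have ke : (k.+1, e) <> (1, 2)%N by case=> k0 e2; apply: hnl; rewrite k0 e2.
(* One inclusion suffices, the two dimensions being equal. *)
move=> W W' gW gW' eqS; apply/eqP; rewrite eq_sym.
rewrite eqEdim (generic_forms_sub F0 _ e_gt0 memV ke gW gW' eqS) //=.
by case: gW gW' => [[_ ->] _] [[_ ->] _].
Qed.
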